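(* Let $k,\Delta\in\mathbb{N}$, let $d,\alpha>0$ and $0<\varepsilon<1$ be constants. For each $n$, let $G_n$ be an $n$-vertex $(d,\alpha)$-degenerate $k$-uniform hypergraph (with constant $\varepsilon$) with maximum degree $\Delta(G_n)\le\Delta$. Then ${\rm th}(G_n)\le n^{-1/d}$; that is, if $p=p(n)$ satisfies $p\,n^{1/d}\to\infty$, then with high probability $G^{(k)}(n,p)$ contains a copy of $G_n$.
   Context: $G^{(k)}(n,p)$ is the random $k$-uniform hypergraph on $n$ vertices in which each $k$-set is an edge independently with probability $p$. For a sequence of $k$-uniform hypergraphs $\{G_n\}$, a threshold function ${\rm th}(G_n)$ is a function such that if $p/{\rm th}(G_n)\to\infty$ then w.h.p. $G^{(k)}(n,p)$ contains a copy of $G_n$, and if $p/{\rm th}(G_n)\to 0$ then w.h.p. it contains none; constant factors are ignored, so ${\rm th}(G_n)\le f(n)$ means a threshold function exists that is $O(f(n))$. For a hypergraph $G$, $m_1(G)=\max\{e(F)/(v(F)-1): F\subseteq G,\ v(F)>1\}$. An $n$-vertex $k$-uniform hypergraph $G$ on vertex set $V$ is $(d,\alpha)$-degenerate if $m_1(G)\le d$ and there is a constant $0<\varepsilon<1$ such that every $U\subseteq V$ with $2\le |U|\le \varepsilon n$ satisfies $e(G[U])\le d(|U|-1)-\alpha$.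
   Formalization: Assumes k ≥ 2 (for k = 1 the claim fails, e.g. all singletons with d = 3, α = 1), and claims existence of a threshold function O(n^{-1/d}) only if G_n has an edge for all large n (otherwise none exists); the ''that is'' claim needs no such guard. *)

(* Defs.v *)
From HB Require Import structures.
From mathcomp Require Import all_boot all_order all_algebra.
From mathcomp Require Import all_classical all_reals all_analysis.

Set Implicit Arguments.
Unset Strict Implicit.
Unset Printing Implicit Defensive.

Import Order.TTheory GRing.Theory Num.Theory.
Import numFieldNormedType.Exports.

Local Open Scope ring_scope.
Local Open Scope classical_set_scope.

(* A hypergraph is its edge set; its vertex set is the whole type [V], so that
   vertices lying in no edge still count. *)
Notation hypergraph V := {set {set V}}.

Definition uniform (V : finType) (k : nat) (G : hypergraph V) : bool :=
  [forall e in G, #|e| == k].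

Definition max_degree (V : finType) (G : hypergraph V) : nat :=
  (\max_(v : V) #|[set e in G | v \in e]|)%N.

Definition induced (V : finType) (G : hypergraph V) (U : {set V}) :
    hypergraph V :=
  [set e in G | e \subset U].

(* A subhypergraph is a pair (vertex set, edge set), not necessarily induced. *)
Definition subhypergraph (V : finType) (F : {set V} * hypergraph V)
    (G : hypergraph V) : bool :=
  (F.2 \subset G) && [forall e in F.2, e \subset F.1].

(* All the quotients are nonnegative, so the default value 0 matters only when
   [V] has at most one vertex and the maximum is over the empty family. *)
Definition m1 (R : realType) (V : finType) (G : hypergraph V) : R :=
  \big[Num.max/0]_(F : {set V} * hypergraph V |
                     subhypergraph F G && (1 < #|F.1|)%N)
    (#|F.2|%:R / (#|F.1|%:R - 1)).

(* (d, alpha)-degeneracy with the witness [eps] made explicit, so that one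
   constant can serve a whole sequence of hypergraphs. *)
Definition degenerate (R : realType) (d alpha eps : R) (V : finType)
    (G : hypergraph V) : Prop :=
  m1 R G <= d /\
  forall U : {set V}, (2 <= #|U|)%N -> #|U|%:R <= eps * #|V|%:R ->
    #|induced G U|%:R <= d * (#|U|%:R - 1) - alpha.

Definition contains_copy (V W : finType) (G : hypergraph V)
    (H : hypergraph W) : bool :=
  [exists phi : {ffun V -> W},
     injectiveb phi && [forall e in G, (phi @: e)%SET \in H]].

(* Probability that the random k-uniform hypergraph on 'I_n, each k-set being
   an edge independently with probability [p], satisfies [A]. *)
Definition random_hypergraph_prob (R : realType) (k n : nat) (p : R)
    (A : pred (hypergraph 'I_n)) : R :=
  \sum_(H : hypergraph 'I_n | uniform k H && A H)
    \prod_(e : {set 'I_n} | #|e| == k) (if e \in H then p else 1 - p).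

Definition whp (R : realType) (k : nat) (p : nat -> R)
    (A : forall n, pred (hypergraph 'I_n)) : Prop :=
  (fun n => random_hypergraph_prob k (p n) (A n)) @ \oo --> (1 : R).

Definition edge_probability (R : realType) (p : nat -> R) : Prop :=
  forall n, 0 <= p n <= 1.

Definition threshold_function (R : realType) (k : nat)
    (G : forall n, hypergraph 'I_n) (th : nat -> R) : Prop :=
  (forall n, 0 < th n) /\
  forall p : nat -> R, edge_probability p ->
    ((fun n => p n / th n) @ \oo --> +oo ->
       whp k p (fun n H => contains_copy (G n) H)) /\
    ((fun n => p n / th n) @ \oo --> (0 : R) ->
       whp k p (fun n H => ~~ contains_copy (G n) H)).

(* An edgeless hypergraph is contained in every H, already at p = 0, so a
   sequence with infinitely many edgeless terms has no threshold function. *)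
Definition threshold_le (R : realType) (k : nat)
    (G : forall n, hypergraph 'I_n) (f : nat -> R) : Prop :=
  exists th : nat -> R, threshold_function k G th /\ th =O_\oo f.

(* Main.v *)
Require Import Defs.
From mathcomp Require Import all_boot all_order all_algebra fingroup perm.
From mathcomp Require Import reals sequences exp ring lra zify.

(* Copies of G are indexed by the permutations of the vertex set.  Expose the
   random hypergraph in a bounded number r of independent rounds, and let the
   current fragment of a copy be the part not yet covered, after replacing the copy
   by another one whose leftover is smallest among those fitting inside the exposed
   edges and the present fragment.  A fragment T that survives a round lies in a
   single copy determined by T and the exposed edges together, so the expected
   proportion of surviving fragments is at most a sum over the subsets T of one
   fragment of p^(-|T|) P(T is contained in a random copy).  If T has components C,
   the bounded degree gives
     P(T is contained in a random copy) <= prod_C n K^|C| n^(-v(C)),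
   and degeneracy turns each factor into (K' n^(-1/d))^|C| n^(-alpha/d).
   Since connected sets of edges are exponentially few, each round shrinks the
   fragments by a factor n^(-alpha/d), and after r > d/alpha + 1 rounds some copy has
   an empty fragment.  This bounds the threshold whenever it exists; it exists by
   the Bollobas-Thomason theorem, where only nonempty G_n matter. *)

Set Implicit Arguments.
Unset Strict Implicit.
Unset Printing Implicit Defensive.

Import Order.TTheory GRing.Theory Num.Theory.
Local Open Scope ring_scope.

(** * Fragmentation of random subsets *)

Lemma ler_sum_inj (R : numDomainType) (I J : finType) (P : pred I)
    (Q : pred J) (h : I -> J) (F : J -> R) :
  {in P &, injective h} -> (forall i, P i -> Q (h i)) ->
  (forall j, Q j -> 0 <= F j) ->
  \sum_(i | P i) F (h i) <= \sum_(j | Q j) F j.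
Proof.
move=> h_inj hPQ F_ge0.
rewrite -(big_imset F (A := P)) //=.
rewrite [leRHS](bigID [in h @: P]) /= -[leLHS]addr0 lerD //.
  rewrite [leRHS](eq_bigl [in h @: P]) // => j.
  case: imsetP => [[i iP ->]|_]; rewrite ?andbF // andbT.
  exact: hPQ.
by apply: sumr_ge0 => j /andP[/F_ge0].
Qed.

Lemma leq_card_fiber (I J : finType) (A : {set I}) (h : I -> J) (c : nat) :
  (forall i, i \in A -> #|[set x in A | h x == h i]| <= c)%N ->
  (#|A| <= #|h @: A| * c)%N.
Proof.
move=> fiber; rewrite -sum1_card (partition_big_imset h) /= -sum_nat_const.
apply: leq_sum => j /imsetP[i iA ->].
apply: leq_trans (fiber i iA); rewrite -sum1_card leq_eqVlt; apply/orP; left.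
by apply/eqP/eq_bigl => x; rewrite inE.
Qed.

Lemma set_ind (T : finType) (P : {set T} -> Prop) :
  P set0 -> (forall (A : {set T}) x, x \notin A -> P A -> P (x |: A)) ->
  forall A : {set T}, P A.
Proof.
move=> P0 PU A; have [n] := ubnP #|A|; elim: n A => // n IH A.
have [->|[x xA]] := set_0Vmem A; first by [].
rewrite (cardsD1 x) xA add1n ltnS => An.
by rewrite -(setD1K xA); apply: PU; [rewrite !inE eqxx | exact: IH].
Qed.

Section RandomSubset.

Variables (R : realFieldType) (X : finType).
Implicit Types (K W T : {set X}) (p q r : R) (f : {set X} -> R).

(** The ground set [K] is a parameter rather than the whole type, so that facts about [Ebern] can be
    proved by adding one element at a time. *)
Definition bern K p W : R := \prod_(e in K) (if e \in W then p else 1 - p).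

Definition Ebern K p f : R := \sum_(W in powerset K) bern K p W * f W.

Lemma bern_ge0 K p W : 0 <= p <= 1 -> 0 <= bern K p W.
Proof.
by case/andP=> p0 p1; apply: prodr_ge0 => e _; case: ifP => // _; rewrite subr_ge0.
Qed.

Lemma Ebern_set0 p f : Ebern set0 p f = f set0.
Proof. by rewrite /Ebern powerset0 big_set1 /bern big_set0 mul1r. Qed.

Lemma Ebern_setU1 e K p f : e \notin K ->
  Ebern (e |: K) p f = p * Ebern K p (fun W => f (e |: W)) + (1 - p) * Ebern K p f.
Proof.
move=> eK; rewrite {1}/Ebern (bigID (fun W => e \in W)) /=; congr (_ + _).
  rewrite mulr_sumr (reindex_onto (fun W => e |: W) (fun W => W :\ e)) /=; last first.
    by move=> W /andP[_ eW]; rewrite setD1K.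
  apply: eq_big => W.
    rewrite !inE eqxx andbT.
    have -> : (((e |: W) :\ e == W) = (e \notin W)).
      apply/eqP/idP => [<-|eW]; first by rewrite !inE eqxx.
      by rewrite setU1K.
    apply/andP/idP => [[/subsetP WK eW]|WK].
      apply/subsetP => x xW; have := WK x; rewrite !inE xW orbT => /(_ isT).
      by case: eqP => // xe; move: eW; rewrite -xe xW.
    by split; [exact: setUS | apply: contra eK; exact: (subsetP WK)].
  move=> /andP[_ /eqP WE]; rewrite mulrA; congr (_ * _).
  rewrite /bern big_setU1 //= !inE eqxx /=; congr (_ * _); apply: eq_bigr => x xK.
  by rewrite !inE; case: eqP => // xe; move: eK; rewrite -xe xK.
rewrite mulr_sumr; apply: eq_big => W.
  rewrite !inE; apply/andP/idP => [[/subsetP WK eW]|WK].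
    apply/subsetP => x xW; have := WK x xW; rewrite !inE.
    by case: eqP => // xe; move: eW; rewrite -xe xW.
  split; last by apply: contra eK; exact: (subsetP WK).
  exact: subset_trans WK (subsetUr _ _).
move=> /andP[_ eW]; rewrite mulrA; congr (_ * _).
by rewrite /bern big_setU1 //= (negbTE eW).
Qed.

Lemma eq_Ebern K p f g : (forall W, W \subset K -> f W = g W) ->
  Ebern K p f = Ebern K p g.
Proof. by move=> fg; apply: eq_bigr => W; rewrite inE => /fg ->. Qed.

Lemma EbernD K p f g : Ebern K p (fun W => f W + g W) = Ebern K p f + Ebern K p g.
Proof. by rewrite /Ebern -big_split; apply: eq_bigr => W _; rewrite mulrDr. Qed.

Lemma EbernZ K p c f : Ebern K p (fun W => c * f W) = c * Ebern K p f.
Proof. by rewrite /Ebern mulr_sumr; apply: eq_bigr => W _; rewrite mulrCA. Qed.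

Lemma Ebern_cst K p c : Ebern K p (fun=> c) = c.
Proof.
elim/set_ind: K => [|K e eK IH]; first by rewrite Ebern_set0.
by rewrite Ebern_setU1 // IH -mulrDl addrC subrK mul1r.
Qed.

Lemma ler_Ebern K p f g : 0 <= p <= 1 ->
  (forall W, W \subset K -> f W <= g W) -> Ebern K p f <= Ebern K p g.
Proof.
move=> p01 fg; apply: ler_sum => W; rewrite inE => /fg.
by apply: ler_wpM2l; exact: bern_ge0.
Qed.

(** Sprinkling: two independent rounds both miss a given element with probability (1 - p)(1 - r). *)
Lemma Ebern_setU K p r f :
  Ebern K (p + r - p * r) f =
  Ebern K p (fun W1 => Ebern K r (fun W2 => f (W1 :|: W2))).
Proof.
elim/set_ind: K f => [|K e eK IH] f; first by rewrite !Ebern_set0 setU0.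
rewrite !Ebern_setU1 // !IH.
pose g W1 := Ebern K r (fun W2 => f (e |: (W1 :|: W2))).
pose h W1 := Ebern K r (fun W2 => f (W1 :|: W2)).
(* Once the first round contains [e], the decision of the second round on [e] is immaterial. *)
have -> : Ebern K p (fun W1 => Ebern (e |: K) r (fun W2 => f (e |: W1 :|: W2))) =
    Ebern K p g.
  apply: eq_Ebern => W _; rewrite Ebern_setU1 //.
  under eq_Ebern do rewrite setUACA setUid.
  under [X in _ + _ * X]eq_Ebern do rewrite -setUA.
  by rewrite -mulrDl addrC subrK mul1r.
have -> : Ebern K p (fun W1 => Ebern (e |: K) r (fun W2 => f (W1 :|: W2))) =
    r * Ebern K p g + (1 - r) * Ebern K p h.
  rewrite -!EbernZ -EbernD; apply: eq_Ebern => W _; rewrite Ebern_setU1 //.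
  by under eq_Ebern do rewrite setUCA.
ring.
Qed.

(** At an element of [T] the left side has the factor (1 - p) p and the right side [p]; elsewhere
    the factors agree. *)
Lemma bern_setU K p W T : 0 <= p <= 1 -> T \subset K -> [disjoint T & W] ->
  bern K p W * p ^+ #|T| <= bern K p (W :|: T).
Proof.
move=> /andP[p0 p1] TK TW.
have -> : p ^+ #|T| = \prod_(e in K) (if e \in T then p else 1).
  rewrite -big_mkcondr /= -prodr_const; apply: eq_bigl => e.
  by rewrite andb_idl //; apply: (subsetP TK).
rewrite -big_split; apply: ler_prod => e _ /=; rewrite !inE.
have [eT|eT] := boolP (e \in T).
  by rewrite (disjointFr TW eT) /= mulr_ge0 ?subr_ge0 //= ler_piMl ?lerBlDr ?lerDl.
by rewrite orbF mulr1 lexx andbT; case: ifP => //; rewrite subr_ge0.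
Qed.

(* [frag] is the smallest leftover of a member lying inside [A i :|: W].  Given
   [Z := W :|: T], where [T] is the leftover of [i], minimality forces [T] to lie
   in any fixed member inside [Z]; hence few [T] are possible for each [Z], while
   passing from [W] to [Z] costs a factor [p ^- #|T|]. *)
Lemma fragmentation (I : finType) (Q : {set I}) (A : I -> {set X}) K p (m : nat) eta :
  0 < p <= 1 -> 0 <= eta -> {in Q, forall i, A i \subset K} ->
  {in Q, forall i, \sum_(T : {set X} | (T \subset A i) && (m <= #|T|)%N)
     p ^- #|T| * #|[set j in Q | T \subset A j]|%:R <= eta} ->
  exists frag : {set X} -> I -> {set X},
    [/\ forall W, {in Q, forall i, frag W i \subset A i},
        forall W, {in Q, forall i, exists2 j, j \in Q & frag W i = A j :\: W} &
        Ebern K p (fun W => #|[set i in Q | (m <= #|frag W i|)%N]|%:R) <= eta].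
Proof.
move=> p01 eta_ge0 AK small; have p_gt0 : 0 < p by case/andP: p01.
have p01' : 0 <= p <= 1 by case/andP: p01 => /ltW -> ->.
pose cand W i j := (j \in Q) && (A j \subset A i :|: W).
pose best W i := [arg min_(j < i | cand W i j) #|A j :\: W|].
have bestP W i : i \in Q -> [/\ best W i \in Q, A (best W i) \subset A i :|: W &
    forall j, j \in Q -> A j \subset A i :|: W ->
      (#|A (best W i) :\: W| <= #|A j :\: W|)%N].
  move=> iQ; rewrite /best; case: arg_minnP => [|j /andP[jQ jA] jmin].
    by rewrite /cand iQ subsetUl.
  by split=> // j' j'Q j'A; apply: jmin; rewrite /cand j'Q.
pose frag W i := A (best W i) :\: W.
have fragA W i : i \in Q -> frag W i \subset A i.
  by move=> /(bestP W)[_ bA _]; rewrite subDset setUC.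
exists frag; split=> //; first by move=> W i /(bestP W)[bQ _ _]; exists (best W i).
have fragW W i : frag W i :\: W = frag W i by rewrite /frag setDDl setUid.
(* [rep] depends on [Z] alone. For [Z = W :|: frag W i] the chosen member is a candidate for (W, i)
   whose leftover lies in [frag W i]; minimality makes the two equal, so [frag W i] lies in that
   member. *)
pose rep (Z : {set X}) := [pick j in Q | A j \subset Z].
have repP W i : i \in Q ->
    exists2 j, rep (W :|: frag W i) = Some j & (j \in Q) && (frag W i \subset A j).
  move=> iQ; rewrite /rep; case: pickP => [j /andP[jQ jZ]|none]; last first.
    have [bQ _ _] := bestP W i iQ; have := none (best W i).
    by by rewrite bQ -subDset subxx.
  exists j => //; rewrite jQ /=.
  have jA : A j \subset A i :|: W.
    by apply: subset_trans jZ _; rewrite setUC setSU // fragA.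
  have [_ _ /(_ j jQ jA) bmin] := bestP W i iQ.
  have jf : A j :\: W \subset frag W i by rewrite subDset.
  have /eqP <- : A j :\: W == frag W i by rewrite eqEcard jf.
  exact: subsetDl.

(* Double counting: [h] sends (W, i) to (Z, T, i), injectively because [W] is [Z] minus [T]. With
   [Z] fixed first, [T] ranges over subsets of the member [rep Z] and [i] over the members
   containing [T], which is the sum bounded by [small]. *)
pose F (x : {set X} * {set X} * I) := bern K p x.1.1 * p ^- #|x.1.2|.
pose src (x : {set X} * I) := [&& x.1 \subset K, x.2 \in Q & (m <= #|frag x.1 x.2|)%N].
pose h (x : {set X} * I) := (x.1 :|: frag x.1 x.2, frag x.1 x.2, x.2).
pose tgt (x : {set X} * {set X} * I) :=
  ((x.1.1 \subset K) && (if rep x.1.1 is Some j then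
     [&& j \in Q, x.1.2 \subset A j & (m <= #|x.1.2|)%N] else false)) &&
  ((x.2 \in Q) && (x.1.2 \subset A x.2)).
have F_ge0 x : 0 <= F x by rewrite mulr_ge0 ?bern_ge0 // invr_ge0 exprn_ge0 // ltW.
apply: (@le_trans _ _ (\sum_(x | src x) F (h x))).
  rewrite /Ebern.
  under eq_bigr => W _.
    rewrite -sum1_card natr_sum mulr_sumr.
    under eq_bigr do rewrite mulr1.
    over.
  rewrite pair_big_dep /=; rewrite [leLHS](eq_bigl src); last first.
    by move=> [W i]; rewrite /src !inE.
  apply: ler_sum => -[W i] /and3P[/= WK iQ _]; rewrite /F /=.
  rewrite ler_pdivlMr ?exprn_gt0 //; apply: bern_setU => //.
    by apply: subset_trans (fragA W i iQ) (AK i iQ).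
  by rewrite -(fragW W i) -setI_eq0 setIDAC setDIl setDv setI0.
apply: (@le_trans _ _ (\sum_(x | tgt x) F x)).
  apply: (@ler_sum_inj _ _ _ src tgt) => [[W i] [W' i']||] //=.
    rewrite /in_mem /= => /and3P[/= WK iQ _] /and3P[/= W'K i'Q _] [eU eT ->].
    congr (_, _); have dis U j : (U :|: frag U j) :\: frag U j = U.
      rewrite setDUl setDv setU0; apply/setDidPl.
      by rewrite -(fragW U j) disjoint_sym -setI_eq0 setIDAC setDIl setDv setI0.
    by rewrite -(dis W i) eU eT dis.
  move=> [W i] /and3P[/= WK iQ mi].
  rewrite /tgt /h /= iQ fragA // subUset WK andbT mi.
  rewrite (subset_trans (fragA W i iQ) (AK i iQ)) /=.
  by have [j -> /andP[-> ->]] := repP W i iQ.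
have -> : \sum_(x | tgt x) F x = \sum_(Z in powerset K) bern K p Z *
    (if rep Z is Some j then if j \in Q then
       \sum_(T : {set X} | (T \subset A j) && (m <= #|T|)%N)
         p ^- #|T| * #|[set j in Q | T \subset A j]|%:R else 0 else 0).
  rewrite -(pair_big_dep
    (fun y : {set X} * {set X} => (y.1 \subset K) && (if rep y.1 is Some j then
     [&& j \in Q, y.2 \subset A j & (m <= #|y.2|)%N] else false))
    (fun y i => (i \in Q) && (y.2 \subset A i)) (fun y i => F (y, i))) /=.
  rewrite -(pair_big_dep (fun Z : {set X} => Z \subset K)
    (fun (Z T : {set X}) => if rep Z is Some j then
     [&& j \in Q, T \subset A j & (m <= #|T|)%N] else false)
    (fun (Z T : {set X}) => \sum_(i | (i \in Q) && (T \subset A i)) F (Z, T, i))) /=.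
  rewrite [RHS](eq_bigl (fun Z : {set X} => Z \subset K)); last by move=> Z; rewrite inE.
  apply: eq_bigr => Z _; case: (rep Z) => [j|]; last by rewrite big_pred0 ?mulr0.
  case: ifP => jQ /=; last by rewrite big_pred0 ?mulr0.
  rewrite mulr_sumr; apply: eq_bigr => T _.
  rewrite mulrA -[X in _ = _ * X%:R]sum1_card natr_sum mulr_sumr.
  by apply: eq_big => i; rewrite ?inE ?mulr1.
rewrite -[leRHS](Ebern_cst K p); apply: ler_sum => Z _.
rewrite ler_wpM2l ?bern_ge0 //; case: (rep Z) => // j; case: ifP => // jQ.
exact: small.
Qed.

(** Every index outside [Q] counts as lost. A round of density [p0] lowers the size bound from
    [m s.+1] to [m s] and loses at most [eta] further indices in expectation. Once the bound is
    [m 0 = 1], a surviving index has an empty fragment, so failure requires that no index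
    survives. *)
Lemma iterated_fragmentation (I : finType) (A0 : I -> {set X}) K p0 (m : nat -> nat) eta :
  0 < p0 < 1 -> 0 <= eta -> (forall i, A0 i \subset K) -> m 0 = 1 ->
  (forall s i (B : {set X}), B \subset A0 i -> (#|B| < m s.+1)%N ->
     \sum_(T : {set X} | (T \subset B) && (m s <= #|T|)%N)
       p0 ^- #|T| * #|[set j | T \subset A0 j]|%:R <= eta) ->
  forall s (Q : {set I}) (A : I -> {set X}) p,
    {in Q, forall i, A i \subset A0 i} -> {in Q, forall i, (#|A i| < m s)%N} ->
    s%:R * p0 <= p -> 0 <= p <= 1 ->
    #|I|%:R * Ebern K p (fun W => (~~ [exists i in Q, A i \subset W])%:R) <=
      #|I|%:R - #|Q|%:R + s%:R * eta.
Proof.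
move=> /andP[p0_gt0 p0_lt1] eta_ge0 A0K m0 small.
elim=> [|s IH] Q A p AA0 Am sp /andP[p_ge0 p_le1].
  rewrite mul0r addr0; have [->|[i iQ]] := set_0Vmem Q.
    rewrite cards0 subr0 -[leRHS]mulr1 ler_wpM2l //.
    rewrite -[leRHS](Ebern_cst K p); apply: ler_Ebern; first by rewrite p_ge0.
    by move=> W _; rewrite lern1 leq_b1.
  rewrite (@eq_Ebern _ _ _ (fun=> 0)) ?Ebern_cst ?mulr0 ?subr_ge0 ?ler_nat ?max_card //.
  move=> W _; suff -> : [exists i in Q, A i \subset W] by [].
  apply/existsP; exists i; rewrite iQ /=; move: (Am i iQ).
  by rewrite m0 ltnS leqn0 cards_eq0 => /eqP ->; rewrite sub0set.
(* The density left for the other rounds: 1 - p = (1 - p0)(1 - r). *)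
pose r := (p - p0) / (1 - p0).
have p0'_gt0 : 0 < 1 - p0 by rewrite subr_gt0.
have p0_le : p0 <= p.
  by apply: le_trans sp; rewrite -[leLHS]mul1r ler_wpM2r ?ler1n // ltW.
have pE : p = p0 + r - p0 * r by rewrite /r; field; rewrite gt_eqF.
have r01 : 0 <= r <= 1.
  rewrite /r divr_ge0 ?subr_ge0 // ?(ltW p0_lt1) //=.
  by rewrite ler_pdivrMr // mul1r lerB.
have sr : s%:R * p0 <= r.
  rewrite ler_pdivlMr //; apply: (@le_trans _ _ (s%:R * p0)); last first.
    by rewrite lerBrDr (le_trans _ sp) // -natr1 mulrDl mul1r.
  by rewrite -[leRHS]mulr1 ler_wpM2l ?mulr_ge0 ?lerBlDr ?lerDl // ltW.
have AK : {in Q, forall i, A i \subset K}.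
  by move=> i iQ; exact: subset_trans (AA0 i iQ) (A0K i).
have p0_le1 : 0 < p0 <= 1 by rewrite p0_gt0 ltW.
have [|frag [fragA fragD fragE]] := @fragmentation I Q A K p0 (m s) eta p0_le1 eta_ge0 AK.
  (* If [T] lies in the current fragment of [j], it lies in [A0 j]; so the spread of the original
     family serves every round. *)
  move=> i iQ; apply: le_trans (small s i (A i) (AA0 i iQ) (Am i iQ)).
  apply: ler_sum => T _; rewrite ler_wpM2l ?invr_ge0 ?exprn_ge0 ?(ltW p0_gt0) //.
  rewrite ler_nat; apply/subset_leq_card/subsetP => j; rewrite !inE => /andP[jQ].
  by move=> /subset_trans; apply; exact: AA0.
pose Q' W := [set i in Q | (#|frag W i| < m s)%N].
have cardQ W : #|Q|%:R = #|Q' W|%:R + #|[set i in Q | (m s <= #|frag W i|)%N]|%:R :> R.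
  rewrite -natrD; congr (_%:R).
  rewrite -(cardsID [set i | (#|frag W i| < m s)%N] Q); congr (_ + _)%N.
    by apply: eq_card => i; rewrite !inE.
  by apply: eq_card => i; rewrite !inE -leqNgt andbC.
have p001 : 0 <= p0 <= 1 by rewrite !ltW.
rewrite pE Ebern_setU -EbernZ.
apply: (@le_trans _ _ (Ebern K p0 (fun W => (#|I|%:R - #|Q|%:R + s%:R * eta) +
     #|[set i in Q | (m s <= #|frag W i|)%N]|%:R))); last first.
  by rewrite EbernD Ebern_cst -natr1 mulrDl mul1r addrA lerD2l.
apply: ler_Ebern => // W1 _.
have -> : #|I|%:R - #|Q|%:R + s%:R * eta + #|[set i in Q | (m s <= #|frag W1 i|)%N]|%:R =
   #|I|%:R - #|Q' W1|%:R + s%:R * eta by rewrite (cardQ W1); ring.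
apply: le_trans (IH (Q' W1) (frag W1) r _ _ sr r01) => [|i|i]; last 2 first.
- by rewrite inE => /andP[iQ _]; exact: subset_trans (fragA W1 i iQ) (AA0 i iQ).
- by rewrite inE => /andP[].
rewrite ler_wpM2l //; apply: ler_Ebern => // W2 _.
rewrite ler_nat; case: existsP => //= noi; rewrite lt0b; apply/existsP => -[i].
rewrite inE => /andP[/andP[iQ _] iW2]; apply: noi.
(* The fragment is the leftover of some [A j], so covering it by [W2] puts all of [A j] inside
   [W1 :|: W2]. *)
have [j jQ jE] := fragD W1 i iQ; exists j; rewrite jQ /=.
by rewrite -subDset -jE.
Qed.

End RandomSubset.

(** * Independent rounds and submultiplicative functions *)

Section Submultiplicative.

Variables (R : realFieldType) (X : finType) (K : {set X}).
Implicit Types (W : {set X}) (p q : R) (f : {set X} -> R).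

(** Split density [q] into a round of density [p] and the rest. The value of [f] at the union is at
    most a product, whose expectation factors by independence. *)
Lemma Ebern_submul_pow f (m : nat) p q :
  (forall W, 0 <= f W <= 1) -> (forall W1 W2, f (W1 :|: W2) <= f W1 * f W2) ->
  0 <= p <= 1 -> 0 <= q <= 1 -> m%:R * p <= q -> Ebern K q f <= Ebern K p f ^+ m.
Proof.
move=> f01 fM p01; have /andP[p_ge0 p_le1] := p01.
have f_le1 W : f W <= 1 by have /andP[] := f01 W.
elim: m q => [|m IH] q q01 mq.
  by rewrite expr0 -[leRHS](Ebern_cst K q); apply: ler_Ebern.
have /andP[q_ge0 q_le1] := q01.
have pq : p <= q by apply: le_trans mq; rewrite -[leLHS]mul1r ler_wpM2r ?ler1n.
(* The residual density divides by 1 - p. When p = 1, the bound on [q] leaves room for this one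
   round only. *)
have [p1|p_neq1] := eqVneq p 1.
  have -> : q = p by apply/eqP; rewrite eq_le pq p1 q_le1.
  have -> : m = 0 by move: (le_trans mq q_le1); rewrite p1 mulr1 lern1 ltnS leqn0 => /eqP.
  by rewrite expr1.
have p_lt1 : p < 1 by rewrite lt_neqAle p_neq1.
have p'_gt0 : 0 < 1 - p by rewrite subr_gt0.
pose r := (q - p) / (1 - p).
have r01 : 0 <= r <= 1.
  by rewrite /r divr_ge0 ?subr_ge0 //= ler_pdivrMr // mul1r lerB.
have mr : m%:R * p <= r.
  rewrite ler_pdivlMr //; apply: (@le_trans _ _ (m%:R * p)); last first.
    by rewrite lerBrDr (le_trans _ mq) // -natr1 mulrDl mul1r.
  by rewrite -[leRHS]mulr1 ler_wpM2l ?mulr_ge0 // lerBlDr lerDl.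
rewrite (_ : q = p + r - p * r); last by rewrite /r; field; rewrite gt_eqF.
have E_ge0 : 0 <= Ebern K p f.
  by rewrite -(Ebern_cst K p 0); apply: ler_Ebern => // W _; have /andP[] := f01 W.
rewrite Ebern_setU exprSr; apply: (@le_trans _ _ (Ebern K r f * Ebern K p f)); last first.
  by rewrite ler_wpM2r // IH.
rewrite -EbernZ; apply: ler_Ebern => // W1 _; rewrite mulrC -EbernZ.
exact: ler_Ebern.
Qed.

(** The union bound. *)
Lemma Ebern_nonempty_le p : 0 <= p <= 1 ->
  Ebern K p (fun W => (W != set0)%:R) <= #|K|%:R * p.
Proof.
move=> p01; have /andP[p_ge0 p_le1] := p01.
elim/set_ind: K => [|A e eA IH]; first by rewrite Ebern_set0 eqxx cards0 mul0r.
rewrite Ebern_setU1 // cardsU1 eA natrD [leRHS]mulrDl mul1r; apply: lerD.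
  rewrite -[leRHS]mulr1 ler_wpM2l // -[leRHS](Ebern_cst A p); apply: ler_Ebern => // W _.
  by rewrite lern1 leq_b1.
apply: le_trans IH; rewrite -[leRHS]mul1r ler_wpM2r ?lerBlDr ?lerDl //.
by rewrite -(Ebern_cst A p 0); apply: ler_Ebern.
Qed.

End Submultiplicative.

(** * Components and connected subsets *)

Section Components.

Variables (X : finType) (r : rel X).
Hypothesis r_sym : symmetric r.
Implicit Types (B C S T : {set X}).

(** Reachability of [C] from [S], phrased by cuts instead of paths: an intermediate set short of [C]
    always has an exit into [C]. Enlarging [S] only drops conditions, which suits exploration
    element by element. *)
Definition grows S C : bool :=
  [forall S' : {set X}, (S \subset S') && (S' \proper C) ==>
     [exists f in C :\: S', [exists g in S', r g f]]].

Definition linked C : bool := (C != set0) && [forall e in C, grows [set e] C].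

Definition in_rel T : rel X := [rel e f | [&& e \in T, f \in T & r e f]].

Definition comps T : {set {set X}} := equivalence_partition (connect (in_rel T)) T.

Lemma growsP S C :
  reflect (forall S', S \subset S' -> S' \proper C ->
             exists f g, [/\ f \in C, f \notin S', g \in S' & r g f])
          (grows S C).
Proof.
apply: (iffP forallP) => [gr S' SS' S'C | gr S'].
  have := gr S'; rewrite SS' S'C => /existsP[f /andP[]].
  by rewrite inE => /andP[fS' fC] /existsP[g /andP[gS' rgf]]; exists f, g.
apply/implyP => /andP[SS' S'C]; have [f [g [fC fS' gS' rgf]]] := gr S' SS' S'C.
by apply/existsP; exists f; rewrite inE fC fS'; apply/existsP; exists g; rewrite gS'.
Qed.

Lemma in_rel_equiv T : {in T & &, equivalence_rel (connect (in_rel T))}.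
Proof.
have sym : connect_sym (in_rel T).
  by apply: sym_connect_sym => e f; rewrite /in_rel /= r_sym andbCA.
move=> x y z _ _ _; split; first exact: connect0.
by move=> xy; apply/idP/idP; apply: connect_trans => //; rewrite sym.
Qed.

Lemma comps_partition T : partition (comps T) T.
Proof. exact: equivalence_partitionP (@in_rel_equiv T). Qed.

Lemma cover_comps T : cover (comps T) = T.
Proof. by have /and3P[/eqP] := comps_partition T. Qed.

Lemma comps_inj : injective comps.
Proof. by move=> T T' eq; rewrite -[T]cover_comps eq cover_comps. Qed.

Lemma compsP C T : C \in comps T ->
  exists2 e, e \in T & C = [set f in T | connect (in_rel T) e f].
Proof. by case/imsetP => e eT ->; exists e. Qed.

Lemma comps_subset C T : C \in comps T -> C \subset T.
Proof. by case/compsP => e _ ->; apply/subsetP => f; rewrite inE => /andP[]. Qed.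

Lemma comps_separated T C C' e f : C \in comps T -> C' \in comps T -> C != C' ->
  e \in C -> f \in C' -> ~~ r e f.
Proof.
move=> CT C'T neq eC fC'; apply: contra neq => ref; apply/eqP.
have eT := subsetP (comps_subset CT) _ eC; have fT := subsetP (comps_subset C'T) _ fC'.
have sym : connect_sym (in_rel T).
  by apply: sym_connect_sym => e1 f1; rewrite /in_rel /= r_sym andbCA.
have [c cT CE] := compsP CT; have [c' c'T C'E] := compsP C'T.
move: eC fC'; rewrite CE C'E !inE eT fT /= => ce c'f.
have cf : connect (in_rel T) c f.
  by apply: connect_trans ce _; apply: connect1; rewrite /in_rel /= eT fT.
have cc' : connect (in_rel T) c c' by apply: connect_trans cf _; rewrite sym.
apply/setP => x; rewrite !inE; congr (_ && _).
by apply/idP/idP; apply: connect_trans => //; rewrite sym.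
Qed.

Lemma comps_linked T C : C \in comps T -> linked C.
Proof.
move=> CT; have [c cT CE] := compsP CT; apply/andP; split.
  by apply/set0Pn; exists c; rewrite CE inE cT connect0.
have sym : connect_sym (in_rel T).
  by apply: sym_connect_sym => e1 f1; rewrite /in_rel /= r_sym andbCA.
apply/forallP => e; apply/implyP => eC; apply/growsP => S eS SC.
have [/existsP[f /andP[fC /existsP[g /andP[gS rgf]]]]|none] :=
    boolP [exists f in C :\: S, [exists g in S, r g f]].
  by move: fC; rewrite inE => /andP[fS fC]; exists f, g.
(* Without an exit, [S] is closed under adjacency in [T] and so contains the whole component of [e],
   contradicting [S \proper C]. *)
have clo : closed (in_rel T) (mem S).
  apply: (intro_closed sym) => x y /= /and3P[xT yT rxy] xS.
  apply/negP => yS; case/negP: none; apply/existsP; exists y.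
  apply/andP; split; last by apply/existsP; exists x; rewrite xS.
  have xC := subsetP (proper_sub SC) _ xS; move: xC; rewrite CE !inE yT.
  move/negP: yS => -> /= /andP[_ cx]; apply: connect_trans cx _.
  by apply: connect1; rewrite /in_rel /= xT yT.
have [_ [x xC xS]] := properP SC.
move: eC xC; rewrite CE !inE => /andP[eT ce] /andP[xT cx].
have ex : connect (in_rel T) e x by apply: connect_trans cx; rewrite sym.
by move: xS; rewrite -(closed_connect clo ex) (subsetP eS) // inE.
Qed.

Variable R : realFieldType.
Implicit Types (w : {set X} -> R) (z : R).

(** Expanding the product gives one term for each family of linked subsets of [B], and a set is
    determined by its family of components. *)
Lemma sum_comps_le B w : (forall C, 0 <= w C) ->
  \sum_(T : {set X} | T \subset B) \prod_(C in comps T) w C <=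
  \prod_(C : {set X} | (C \subset B) && linked C) (1 + w C).
Proof.
move=> w_ge0; pose P C := (C \subset B) && linked C.
have -> : \prod_(C : {set X} | P C) (1 + w C) =
    \sum_(J : {set {set X}} | J \subset [set C | P C]) \prod_(C in J) w C.
  rewrite [LHS]big_mkcond (eq_bigr (fun C => (if P C then w C else 0) + 1)); last first.
    by move=> C _; case: ifP => _; rewrite ?add0r // addrC.
  rewrite bigA_distr [RHS]big_mkcond; apply: eq_bigr => J _.
  case: ifP => [/subsetP JP|/negbT/subsetPn[C CJ]]; last first.
    by rewrite inE => nP; rewrite (bigD1 C) //= CJ (negbTE nP) mul0r.
  rewrite [RHS]big_mkcond; apply: eq_bigr => C _; case: ifP => // /JP.
  by rewrite inE => ->.
apply: (ler_sum_inj (F := fun J : {set {set X}} => \prod_(C in J) w C)).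
- by move=> T T' _ _; exact: comps_inj.
- move=> T TB; apply/subsetP => C CT; rewrite inE /P.
  by rewrite (subset_trans (comps_subset CT) TB) (comps_linked CT).
- by move=> J _; apply: prodr_ge0.
Qed.

Definition frontier S B : {set X} := [set f in B | [exists g in S, r g f]].

(* Exploring the members of [S :|: T] one frontier element at a time: an element
   [e] is either discarded or kept, and keeping it costs [z] and enlarges the
   frontier by at most [D]. *)
Lemma sum_grows_le (D : nat) z S B : 0 <= z -> (1 + 2 * z) ^+ D <= 2 ->
  [disjoint S & B] -> {in B, forall e, (#|[set f in B | r e f]| <= D)%N} ->
  \sum_(T : {set X} | (T \subset B) && grows S (S :|: T)) z ^+ #|T| <=
    (1 + 2 * z) ^+ #|frontier S B|.
Proof.
move=> z_ge0 zD; have [n] := ubnP #|B|; elim: n S B => // n IH S B Bn SB deg.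
have z1 : 1 <= 1 + 2 * z by rewrite lerDl mulr_ge0.
(* With an empty frontier nothing can be added to [S], so only the term of the empty set
   survives. *)
have [L0|[e eL]] := set_0Vmem (frontier S B).
  rewrite L0 cards0 expr0 (bigD1 set0) /=; last first.
    rewrite sub0set setU0; apply/growsP => S' SS' S'S.
    by have := proper_sub_trans S'S SS'; rewrite properxx.
  rewrite cards0 expr0 big_pred0 ?addr0 // => T; apply/negP => /andP[/andP[TB gr] T0].
  have [x xT] := set0Pn _ T0; have xS : x \notin S.
    by apply/negP => xS; have := disjointFr SB xS; rewrite (subsetP TB).
  have [|f [g [fC fS gS rgf]]] := growsP _ _ gr S (subxx _).
    by apply/properP; split; [exact: subsetUl | exists x; rewrite ?inE ?xT ?orbT].
  have : f \in frontier S B; last by rewrite L0 inE.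
  rewrite inE (subsetP TB) /=; last by move: fC; rewrite inE (negbTE fS).
  by apply/existsP; exists g; rewrite gS.
have eB : e \in B by move: eL; rewrite inE => /andP[].
have eS : e \notin S by apply/negP => /(disjointFr SB); rewrite eB.
pose B' := B :\ e.
have B'B : B' \subset B := subsetDl _ _.
have B'n : (#|B'| < n)%N by move: Bn; rewrite (cardsD1 e B) eB.
have deg' : {in B', forall f, (#|[set g in B' | r f g]| <= D)%N}.
  move=> f fB'; apply: leq_trans (deg f (subsetP B'B _ fB')).
  by apply/subset_leq_card/subsetP => g; rewrite !inE => /andP[/andP[_ ->]].
have SB' : [disjoint S & B'] by apply: disjointWr SB.
have eSB' : [disjoint e |: S & B'].
  by rewrite disjoint_sym disjoints_subset; apply/subsetP => x; rewrite !inE negb_or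
    => /andP[-> xB] /=; rewrite (disjointFl SB xB).
rewrite (bigID (fun T : {set X} => e \in T)) /=.
have LE : #|frontier S B| = #|frontier S B'|.+1.
  rewrite (cardsD1 e) eL add1n; congr _.+1; apply: eq_card => x.
  by rewrite !inE andbA.
have out :
    \sum_(T : {set X} | (T \subset B) && grows S (S :|: T) && (e \notin T)) z ^+ #|T|
    <= (1 + 2 * z) ^+ #|frontier S B'|.
  apply: le_trans (IH S B' B'n SB' deg'); rewrite le_eqVlt; apply/orP; left.
  apply/eqP/eq_bigl => T; rewrite andbAC; congr (_ && _).
  by rewrite /B' subsetD1.
have into :
    \sum_(T : {set X} | (T \subset B) && grows S (S :|: T) && (e \in T)) z ^+ #|T|
    <= z * (1 + 2 * z) ^+ #|frontier (e |: S) B'|.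
  apply: (@le_trans _ _ (z * \sum_(T : {set X} |
      (T \subset B') && grows (e |: S) (e |: S :|: T)) z ^+ #|T|));
    last by rewrite ler_wpM2l // IH.
  rewrite mulr_sumr (eq_bigr (fun T : {set X} => z * z ^+ #|T :\ e|)); last first.
    by move=> T /andP[_ eT]; rewrite (cardsD1 e T) eT exprS.
  apply: (ler_sum_inj (h := fun T => T :\ e) (F := fun T => z * z ^+ #|T|)).
  - move=> T T'; rewrite !unfold_in => /andP[_ eT] /andP[_ eT'] eq.
    by rewrite -(setD1K eT) eq setD1K.
  - move=> T /andP[/andP[TB /growsP gr] eT].
    rewrite /B' setSD //=.
    have -> : e |: S :|: T :\ e = S :|: T.
      by rewrite (setUC [set e]) -setUA setD1K.
    apply/growsP => S' SS'; apply: gr; apply: subset_trans SS'; exact: subsetUr.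
  - by move=> T _; rewrite mulr_ge0 // exprn_ge0.
have LD : (#|frontier (e |: S) B'| <= D + #|frontier S B'|)%N.
  apply: leq_trans (leq_add (deg e eB) (leqnn _)).
  apply: leq_trans (leq_card_setU _ _); apply/subset_leq_card/subsetP => f.
  rewrite !inE => /andP[/andP[fe fB] /existsP[g /andP[]]]; rewrite !inE fB fe /=.
  case/orP => [/eqP ->|gS] rgf; first by rewrite rgf.
  by apply/orP; right; apply/existsP; exists g; rewrite gS.
(* By [zD] the extra [D] frontier elements cost at most a factor 2, so keeping [e] contributes at
   most 2z times the bound for discarding it. Together they give 1 + 2z, the factor for the frontier
   element [e]. *)
rewrite addrC LE exprS mulrDl mul1r; apply: lerD out _; apply: (le_trans into).
rewrite -[leRHS]mulrA [leRHS]mulrCA ler_wpM2l //.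
apply: le_trans (ler_weXn2l z1 LD) _; rewrite exprD ler_wpM2r // exprn_ge0 //.
exact: le_trans ler01 z1.
Qed.

(** Explore from [e]: the initial frontier has at most [D] elements, so [sum_grows_le] gives at most
    2, and [e] itself costs [z]. *)
Lemma sum_linked_le (D : nat) z B e : 0 <= z -> (1 + 2 * z) ^+ D <= 2 -> e \in B ->
  {in B, forall e, (#|[set f in B | r e f]| <= D)%N} ->
  \sum_(C : {set X} | [&& C \subset B, linked C & e \in C]) z ^+ #|C| <= 2 * z.
Proof.
move=> z_ge0 zD eB deg; pose B' := B :\ e.
have B'B : B' \subset B := subsetDl _ _.
have deg' : {in B', forall f, (#|[set g in B' | r f g]| <= D)%N}.
  move=> f fB'; apply: leq_trans (deg f (subsetP B'B _ fB')).
  by apply/subset_leq_card/subsetP => g; rewrite !inE => /andP[/andP[_ ->]].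
have eB' : [disjoint [set e] & B'] by rewrite disjoints1 !inE eqxx.
have z1 : 1 <= 1 + 2 * z by rewrite lerDl mulr_ge0.
apply: (@le_trans _ _ (z * \sum_(T : {set X} |
    (T \subset B') && grows [set e] (e |: T)) z ^+ #|T|)).
  rewrite mulr_sumr (eq_bigr (fun T : {set X} => z * z ^+ #|T :\ e|)); last first.
    by move=> T /and3P[_ _ eT]; rewrite (cardsD1 e T) eT exprS.
  apply: (ler_sum_inj (h := fun T => T :\ e) (F := fun T => z * z ^+ #|T|)).
  - move=> T T'; rewrite !unfold_in => /and3P[_ _ eT] /and3P[_ _ eT'] eq.
    by rewrite -(setD1K eT) eq setD1K.
  - move=> T /and3P[TB /andP[_ /forallP/(_ e)]] /[swap] eT.
    by rewrite eT /= setD1K // => ->; rewrite /B' setSD.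
  - by move=> T _; rewrite mulr_ge0 // exprn_ge0.
rewrite mulrC ler_wpM2r //; apply: le_trans (sum_grows_le z_ge0 zD eB' deg') _.
apply: le_trans zD; rewrite ler_weXn2l //; apply: leq_trans (deg e eB).
apply/subset_leq_card/subsetP => f; rewrite !inE => /andP[/andP[_ ->]].
by move=> /existsP[g /andP[]]; rewrite inE => /eqP ->.
Qed.

End Components.

(** * Random copies of a bounded degree hypergraph *)

Section Embeddings.

Variables (V : finType) (G : {set {set V}}) (k Delta : nat).
Hypotheses (G_unif : {in G, forall e : {set V}, #|e| = k})
  (G_deg : forall v, (#|[set e in G | v \in e]| <= Delta)%N) (k_gt0 : (0 < k)%N).
Implicit Types (T C S : {set {set V}}) (e f g : {set V}) (s : {perm V}).

Definition meets e f := ~~ [disjoint e & f].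

Lemma meets_sym : symmetric meets.
Proof. by move=> e f; rewrite /meets disjoint_sym. Qed.

(* The edge set of the copy of [G] placed by the inverse of [s]. *)
Definition pulled_back s : {set {set V}} := [set e : {set V} | s @: e \in G].

Definition embeddings T : {set {perm V}} := [set s | T \subset pulled_back s].

(** The value [None] off [U] puts restrictions to different sets into one type. *)
Definition restriction (U : {set V}) s : {ffun V -> option V} :=
  [ffun x => if x \in U then Some (s x) else None].

Definition restrictions T := restriction (cover T) @: embeddings T.

Lemma pulled_back_card s e : e \in pulled_back s -> #|e| = k.
Proof. by rewrite inE => /G_unif; rewrite card_imset //; exact: perm_inj. Qed.

Lemma card_hypergraph_le : (#|G| <= #|V| * Delta)%N.
Proof.
apply: (@leq_trans (\sum_(e in G) #|e|)).
  by rewrite -sum1_card; apply: leq_sum => e /G_unif ->.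
rewrite (eq_bigr (fun e => \sum_(v : V) (v \in e : nat))%N); last first.
  by move=> e _; rewrite -sum1_card big_mkcond; apply: eq_bigr => v _; case: (v \in e).
rewrite exchange_big /= -sum_nat_const; apply: leq_sum => v _.
apply: leq_trans (G_deg v); rewrite -big_mkcondr /= sum1_card.
by apply/subset_leq_card/subsetP => e; rewrite unfold_in inE.
Qed.

(** Permutations with the same restriction differ by a permutation fixing [cover T] pointwise. *)
Lemma card_embeddings_le T :
  (#|embeddings T| <= #|restrictions T| * (#|V| - #|cover T|)`!)%N.
Proof.
apply: leq_card_fiber => s sT.
have <- : #|perm_on (~: cover T)| = (#|V| - #|cover T|)`!.
  by rewrite card_perm cardsCs setCK.
rewrite -(card_imset _ (mulIg s^-1)%g); apply/subset_leq_card/subsetP => t /imsetP[u].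
rewrite inE => /andP[_ /eqP/ffunP eq] -> {t}; apply/subsetP => x; rewrite inE permM => nx.
apply/setCP => xT; case/eqP: nx.
by have := eq x; rewrite !ffunE xT => -[->]; rewrite permK.
Qed.

Lemma cover_setU1 e T : cover (e |: T) = e :|: cover T.
Proof.
apply/setP => x; rewrite inE; apply/bigcupP/orP.
  case=> f; rewrite !inE => /orP[/eqP -> ? | fT xf]; first by left.
  by right; apply/bigcupP; exists f.
case=> [xe|/bigcupP[f fT xf]]; first by exists e; rewrite // setU11.
by exists f; rewrite // setU1r.
Qed.

(** To extend a restriction to [e], first choose the image of [e] among at most [c] sets, then one
    of at most k^k maps from [e] into that image. *)
Lemma card_restrictions_setU1 e T (c : nat) : #|e| = k ->
  (forall s, s \in embeddings (e |: T) ->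
     exists2 H : {set {set V}}, (#|H| <= c)%N &
       forall s', s' \in embeddings (e |: T) ->
         restriction (cover T) s' = restriction (cover T) s -> s' @: e \in H) ->
  (#|restrictions (e |: T)| <= #|restrictions T| * (c * k ^ k))%N.
Proof.
move=> ek compat.
pose cut (U : {set V}) (rho : {ffun V -> option V}) :=
  [ffun x => if x \in U then rho x else None].
have cutE (U U' : {set V}) s : U \subset U' -> cut U (restriction U' s) = restriction U s.
  by move=> /subsetP UU'; apply/ffunP => x; rewrite !ffunE; case: ifP => // /UU' ->.
have cov : cover (e |: T) = e :|: cover T := cover_setU1 e T.
apply: (@leq_trans (#|cut (cover T) @: restrictions (e |: T)| * (c * k ^ k))); last first.
  rewrite leq_mul2r; apply/orP; right; apply/subset_leq_card/subsetP => rho.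
  case/imsetP=> _ /imsetP[s sT ->] ->.
  rewrite cutE ?cov ?subsetUr //; apply: imset_f.
  by move: sT; rewrite !inE; apply: subset_trans; exact: subsetUr.
apply: leq_card_fiber => _ /imsetP[s sT ->]; rewrite cutE ?cov ?subsetUr //.
set F := [set x in _ | _]; have [H Hc HP] := compat s sT.
pose im (rho : {ffun V -> option V}) := [set y | Some y \in rho @: e].
have imE (U : {set V}) s' : e \subset U -> im (restriction U s') = s' @: e.
  move=> /subsetP eU; apply/setP => y; rewrite inE.
  apply/imsetP/imsetP => [[x xe]|[x xe ->]]; last by exists x; rewrite // ffunE eU.
  by rewrite ffunE eU // => -[->]; exists x.
apply: (@leq_trans (#|im @: F| * k ^ k)); last first.
  rewrite leq_mul2r; apply/orP; right; apply: leq_trans Hc.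
  apply/subset_leq_card/subsetP => E.
  case/imsetP=> rho + ->; rewrite inE => /andP[/imsetP[s' s'T ->]].
  by rewrite cutE ?cov ?subsetUr // imE ?cov ?subsetUl // => /eqP; exact: HP.
apply: leq_card_fiber => rho; rewrite inE => /andP[/imsetP[s1 s1T ->] _].
rewrite imE ?cov ?subsetUl //.
have -> : (k ^ k = #|pffun_on None e (mem (Some @: (s1 @: e)))|)%N.
  rewrite card_pffun_on card_imset; last by move=> ? ? [].
  by rewrite card_imset ?ek //; exact: perm_inj.
(* Within the fibre the values on [cover T] are fixed, so the values on [e] determine the whole
   restriction. *)
rewrite -(card_in_imset (f := cut e)); last first.
  move=> rho1 rho2; rewrite !inE => /andP[/andP[/imsetP[u uT ->] /eqP e1] _].
  move=> /andP[/andP[/imsetP[u' uT' ->] /eqP e2] _].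
  move: e1 e2; rewrite !cutE ?cov ?subsetUl ?subsetUr // => e1 e2 e3.
  apply/ffunP => x; rewrite !ffunE inE; have [xe|xe] /= := boolP (x \in e).
    by have /ffunP/(_ x) := e3; rewrite !ffunE xe.
  have /ffunP/(_ x) := e1; have /ffunP/(_ x) := e2.
  by rewrite !ffunE; case: ifP => // _ -> ->.
apply/subset_leq_card/subsetP => psi /imsetP[rho'].
rewrite !inE => /andP[/andP[/imsetP[u uT ->] _] /eqP].
rewrite imE ?cov ?subsetUl // cutE ?subsetUl // => ue ->.
apply/pffun_onP; split.
  by apply/supportP => x xe; rewrite ffunE (negbTE xe).
move=> y /imageP[x xe ->]; rewrite ffunE xe; apply: imset_f; rewrite -ue; exact: imset_f.
Qed.

Lemma card_restrictions_root e T : #|e| = k ->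
  (#|restrictions (e |: T)| <= #|restrictions T| * (#|V| * (Delta * k ^ k)))%N.
Proof.
move=> ek; rewrite [X in (_ <= _ * X)%N]mulnA; apply: card_restrictions_setU1 => // s _.
exists G; first exact: card_hypergraph_le.
by move=> s'; rewrite inE => /subsetP/(_ e); rewrite setU11 inE => /(_ isT).
Qed.

(** A vertex shared with [f] already has its image, and at most [Delta] edges of [G] contain that
    image. *)
Lemma card_restrictions_meets e f T : #|e| = k -> f \in T -> meets f e ->
  (#|restrictions (e |: T)| <= #|restrictions T| * (Delta * k ^ k))%N.
Proof.
move=> ek fT /pred0Pn[v /andP[/= vf ve]]; apply: card_restrictions_setU1 => // s _.
exists [set E in G | s v \in E]; first exact: G_deg.
move=> s'; rewrite inE => /subsetP/(_ e); rewrite setU11 !inE => /(_ isT) s'e.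
have vT : v \in cover T by apply/bigcupP; exists f.
by move=> /ffunP/(_ v); rewrite !ffunE vT => -[<-]; rewrite s'e imset_f.
Qed.

(** Add the edges of [C] one at a time, each after the first meeting an earlier one; only the first
    costs a factor [#|V|]. *)
Lemma card_restrictions_linked C T : {in C, forall e, #|e| = k} -> linked meets C ->
  (#|restrictions (C :|: T)| <= #|restrictions T| * (#|V| * (Delta * k ^ k) ^ #|C|))%N.
Proof.
move=> Ck /andP[/set0Pn[e eC] /forallP/(_ e)]; rewrite eC /= => /growsP gr.
set D := (Delta * k ^ k)%N.
have [j jC] : exists j, (j.+1 = #|C|)%N.
  by exists #|C|.-1; rewrite prednK // (cardD1 e) eC.
suff step i : (i <= j)%N -> exists S : {set {set V}},
    [/\ e \in S, S \subset C, #|S| = i.+1 &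
    (#|restrictions (S :|: T)| <= #|restrictions T| * (#|V| * D ^ i.+1))%N].
  have [S [_ SC Sj le]] := step j (leqnn j).
  suff <- : S = C by rewrite Sj.
  by apply/eqP; rewrite eqEcard SC Sj jC leqnn.
elim: i => [_|i IH ij].
  exists [set e]; rewrite set11 sub1set eC cards1; split=> //.
  by rewrite expn1; apply: card_restrictions_root; apply: Ck.
have [S [eS SC Si le]] := IH (ltnW ij).
have [||f [g [fC fS gS gf]]] := gr S; first by rewrite sub1set.
  by rewrite properEcard SC Si -jC ltnS.
exists (f |: S); split.
- by rewrite !inE eS orbT.
- by rewrite subUset sub1set fC.
- by rewrite cardsU1 fS Si.
rewrite -setUA; apply: leq_trans (card_restrictions_meets (f := g) _ _ gf) _.
- exact: Ck.
- by rewrite inE gS.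
by rewrite -/D expnSr (mulnA #|V|) (mulnA #|restrictions T|) leq_mul2r le orbT.
Qed.

Lemma card_restrictions_cover (P : {set {set {set V}}}) :
  {in P, forall C, {in C, forall e, #|e| = k} /\ linked meets C} ->
  (#|restrictions (cover P)| <= \prod_(C in P) (#|V| * (Delta * k ^ k) ^ #|C|))%N.
Proof.
elim/set_ind: P => [_|P C CP IH PP].
  rewrite big_set0 /restrictions /cover big_set0 big_set0.
  apply: (@leq_trans #|[set [ffun=> None : option V] : {ffun V -> option V}]|);
    last by rewrite cards1.
  apply/subset_leq_card/subsetP => _ /imsetP[s _ ->]; rewrite inE; apply/eqP/ffunP => x.
  by rewrite !ffunE inE.
have -> : cover (C |: P) = C :|: cover P by rewrite /cover big_setU1.
rewrite big_setU1 //= [leqRHS]mulnC; have [Ck lC] := PP C (setU11 _ _).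
apply: leq_trans (card_restrictions_linked _ Ck lC) _.
by rewrite leq_mul2r IH ?orbT // => C' C'P; apply: PP; rewrite setU1r.
Qed.

(** Edges from different components do not meet, so the components cover disjoint vertex sets. *)
Lemma card_cover_comps T :
  #|cover T| = (\sum_(C in comps meets T) #|cover C|)%N.
Proof.
pose P := [set cover C | C in comps meets T].
have sep C C' : C \in comps meets T -> C' \in comps meets T -> C != C' ->
    [disjoint cover C & cover C'].
  move=> CT C'T neq; apply/pred0P => x; apply/negP => /andP[/=].
  move=> /bigcupP[e eC xe] /bigcupP[f fC' xf].
  case/negP: (comps_separated meets_sym CT C'T neq eC fC'); apply/pred0Pn; exists x.
  by rewrite /= xe.
rewrite -{1}(cover_comps meets_sym T).
have -> : cover (cover (comps meets T)) = \bigcup_(C in comps meets T) cover C.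
  apply/setP => x; apply/bigcupP/bigcupP.
    move=> [e /bigcupP[C CT eC] xe].
    by exists C => //; apply/bigcupP; exists e.
  move=> [C CT /bigcupP[e eC xe]].
  by exists e => //; apply/bigcupP; exists C.
rewrite [\bigcup_(C in _) _]big_mkcond -sum1_card partition_disjoint_bigcup /=; last first.
  move=> C C' neq; case: ifP => CT; last by rewrite disjoints_subset sub0set.
  by case: ifP => C'T; [exact: sep | rewrite disjoint_sym disjoints_subset sub0set].
rewrite [RHS]big_mkcond; apply: eq_bigr => C _; rewrite sum1_card.
by case: ifP => // _; rewrite cards0.
Qed.

Lemma card_embeddings_comps T : {in T, forall e, #|e| = k} ->
  (#|embeddings T| <= (\prod_(C in comps meets T) (#|V| * (Delta * k ^ k) ^ #|C|)) *
     (#|V| - \sum_(C in comps meets T) #|cover C|)`!)%N.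
Proof.
move=> Tk; apply: leq_trans (card_embeddings_le T) _.
rewrite -card_cover_comps leq_mul2r; apply/orP; right.
have := @card_restrictions_cover (comps meets T); rewrite (cover_comps meets_sym); apply.
move=> C CT; split; last exact: (comps_linked meets_sym) CT.
by move=> e eC; apply: Tk; exact: subsetP (comps_subset CT) _ eC.
Qed.

End Embeddings.

(** The falling factorial of 2v of length v is at least v^v factor by factor, and it equals v! times
    a binomial coefficient that is at most 2^(2v). *)
Lemma expn_self_le_fact v : (v ^ v <= 4 ^ v * v`!)%N.
Proof.
have ffact_ge : (v ^ v <= (v + v) ^_ v)%N.
  rewrite ffact_prod -[X in (_ ^ X)%N]card_ord -prod_nat_const.
  by apply: leq_prod => i _; have := ltn_ord i; lia.
apply: leq_trans ffact_ge _; rewrite -bin_ffact leq_mul2r; apply/orP; right.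
rewrite (_ : (4 = 2 ^ 2)%N) // -expnM mul2n -addnn (Pascal 1 1).
have lt_v : (v < (v + v).+1)%N by rewrite ltnS leq_addr.
by rewrite (bigD1 (Ordinal lt_v)) //= !exp1n !muln1 leq_addr.
Qed.

(** Compare n (v - i) <= v (n - i) for every i < v, then apply the bound on v^v. *)
Lemma expn_fact_le n v : (v <= n)%N -> (n ^ v * (n - v)`! <= 4 ^ v * n`!)%N.
Proof.
move=> vn; rewrite -(ffact_fact vn) mulnA leq_mul2r; apply/orP; right.
have [->|v_gt0] := posnP v; first by rewrite !expn0 ffactn0.
have le : (n ^ v * v`! <= v ^ v * n ^_ v)%N.
  have powE a : (a ^ v = \prod_(i < v) a)%N by rewrite prod_nat_const card_ord.
  rewrite -ffactnn !ffact_prod !powE -!big_split /=.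
  by apply: leq_prod => i _; rewrite !mulnBr (mulnC v n) leq_sub2l // leq_mul2r vn orbT.
rewrite -(leq_pmul2l (_ : 0 < v ^ v)%N) ?expn_gt0 ?v_gt0 //.
rewrite [leqRHS]mulnCA; apply: leq_trans (leq_mul (leqnn (4 ^ v)) le).
by rewrite [leqRHS]mulnCA mulnC leq_mul2l expn_self_le_fact orbT.
Qed.

(** * Spread of a random copy *)

Section Spread.

Variables (R : realType) (V : finType) (G : {set {set V}}) (k Delta : nat).
Hypotheses (G_unif : {in G, forall e : {set V}, #|e| = k})
  (G_deg : forall v, (#|[set e in G | v \in e]| <= Delta)%N) (k_gt0 : (0 < k)%N).
Implicit Types (T C B : {set {set V}}).

Local Notation n := #|V|.

(** Divided by n!, this bounds the probability that a random copy contains [T]. Fixing the v covered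
    vertices costs (n - v)! / n!, at most (4 / n)^v, and v splits over the components. *)
Lemma embeddings_spread T : (0 < n)%N -> {in T, forall e : {set V}, #|e| = k} ->
  #|embeddings G T|%:R <= n`!%:R * \prod_(C in comps (@meets V) T)
    (n%:R * (Delta * k ^ k)%:R ^+ #|C| * (4 / n%:R) ^+ #|cover C|) :> R.
Proof.
move=> n_gt0 Tk; set v := (\sum_(C in comps (@meets V) T) #|cover C|)%N.
have vn : (v <= n)%N by rewrite /v -card_cover_comps max_card.
rewrite big_split /= -expr_sum -/v.
apply: (@le_trans _ _ ((\prod_(C in comps (@meets V) T) (n * (Delta * k ^ k) ^ #|C|) *
     (n - v)`!)%N%:R)).
  by rewrite ler_nat; apply: card_embeddings_comps.
rewrite natrM natr_prod mulrCA; under eq_bigr do rewrite natrM natrX.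
rewrite ler_wpM2l //; first by apply: prodr_ge0 => C _; rewrite mulr_ge0 ?exprn_ge0.
rewrite expr_div_n mulrA ler_pdivlMr ?exprn_gt0 ?ltr0n //.
by rewrite -!natrX -!natrM ler_nat mulnC (mulnC n`!) expn_fact_le.
Qed.

Lemma pulled_back_meets s B e : B \subset pulled_back G s -> e \in B ->
  (#|[set f in B | meets e f]| <= k * Delta)%N.
Proof.
move=> BG eB.
rewrite -(pulled_back_card G_unif (subsetP BG _ eB)) -sum_nat_const.
apply: (@leq_trans (\sum_(x in e) #|[set f in B | x \in f]|)).
  rewrite -sum1_card (eq_bigr (fun x => \sum_(f in B) (x \in f : nat))%N); last first.
    move=> x _; rewrite -sum1_card -big_mkcondr.
    by apply: eq_bigl => f; rewrite inE.
  rewrite exchange_big /= (eq_bigl (fun f => (f \in B) && meets e f)); last first.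
    by move=> f; rewrite inE.
  rewrite big_mkcondr; apply: leq_sum => f fB; case: ifP => // /pred0Pn[x /andP[/= xe xf]].
  by rewrite (bigD1 x) //= xf.
apply: leq_sum => x _; apply: leq_trans (G_deg (s x)).
rewrite -(card_imset _ (imset_inj (@perm_inj _ s))).
apply/subset_leq_card/subsetP => _ /imsetP[f + ->].
rewrite !inE => /andP[/(subsetP BG)]; rewrite inE => -> xf.
exact: imset_f.
Qed.

(** The condition [m <= #|T|] is traded for the weight [lam ^+ #|T|] divided by [lam ^+ m]. The
    remaining sum of products over components is at most the exponential of a sum over linked sets,
    which the exploration bound controls. *)
Lemma sum_embeddings_le s B (m : nat) (p lam x y : R) : (0 < n)%N ->
  B \subset pulled_back G s -> 0 < p -> 1 <= lam -> 0 <= x -> 0 <= y ->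
  (1 + 2 * (lam * x)) ^+ (k * Delta) <= 2 ->
  (forall C, C \subset B -> linked (@meets V) C ->
     p ^- #|C| * (n%:R * (Delta * k ^ k)%:R ^+ #|C| * (4 / n%:R) ^+ #|cover C|)
       <= x ^+ #|C| * y) ->
  \sum_(T : {set {set V}} | (T \subset B) && (m <= #|T|)%N)
     p ^- #|T| * #|embeddings G T|%:R <=
  n`!%:R * (lam ^- m * expR (#|B|%:R * y * (2 * (lam * x)))).
Proof.
move=> n_gt0 BG p_gt0 lam1 x_ge0 y_ge0 small wC; set z := lam * x.
have lam_gt0 : 0 < lam by apply: lt_le_trans lam1.
have z_ge0 : 0 <= z by rewrite mulr_ge0 // ltW.
have deg : {in B, forall e, (#|[set f in B | meets e f]| <= k * Delta)%N}.
  by move=> e eB; apply: pulled_back_meets BG eB.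
apply: (@le_trans _ _ (n`!%:R * (lam ^- m * \sum_(T : {set {set V}} | T \subset B)
    \prod_(C in comps (@meets V) T) (z ^+ #|C| * y)))).
  rewrite !mulr_sumr big_mkcondr; apply: ler_sum => T TB; case: ifP => mT; last first.
    rewrite !mulr_ge0 ?invr_ge0 ?exprn_ge0 ?(ltW lam_gt0) // prodr_ge0 // => C _.
    by rewrite mulr_ge0 ?exprn_ge0.
  have Tk : {in T, forall e : {set V}, #|e| = k}.
    by move=> e eT; apply: (pulled_back_card G_unif (s := s)); apply/(subsetP BG)/(subsetP TB).
  apply: (@le_trans _ _ (p ^- #|T| * (n`!%:R * \prod_(C in comps (@meets V) T)
    (n%:R * (Delta * k ^ k)%:R ^+ #|C| * (4 / n%:R) ^+ #|cover C|)))).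
    by rewrite ler_wpM2l ?invr_ge0 ?exprn_ge0 ?(ltW p_gt0) // embeddings_spread.
  rewrite mulrCA ler_wpM2l //.
  have cardT : #|T| = (\sum_(C in comps (@meets V) T) #|C|)%N.
    exact: card_partition (comps_partition (@meets_sym V) T).
  rewrite -exprVn {1}cardT expr_sum -big_split /=.
  apply: (@le_trans _ _ (\prod_(C in comps (@meets V) T) (x ^+ #|C| * y))).
    apply: ler_prod => C CT; rewrite exprVn.
    rewrite !mulr_ge0 ?invr_ge0 ?exprn_ge0 ?divr_ge0 // ?(ltW p_gt0) //=.
    apply: wC; first exact: subset_trans (comps_subset CT) TB.
    exact: (comps_linked (@meets_sym V)) CT.
  rewrite -exprVn /z; under [X in _ <= _ * X]eq_bigr do rewrite exprMn -mulrA.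
  rewrite [X in _ <= _ * X]big_split /= -expr_sum -cardT mulrA -[leLHS]mul1r ler_wpM2r //.
    by apply: prodr_ge0 => C _; rewrite mulr_ge0 ?exprn_ge0.
  by rewrite exprVn mulrC ler_pdivlMr ?exprn_gt0 // mul1r ler_weXn2l.
rewrite ler_wpM2l // ler_wpM2l ?invr_ge0 ?exprn_ge0 ?(ltW lam_gt0) //.
apply: (le_trans (sum_comps_le (@meets_sym V) B _)) => [C|].
  by rewrite mulr_ge0 ?exprn_ge0.
apply: (@le_trans _ _ (expR (\sum_(C : {set {set V}} |
    (C \subset B) && linked (@meets V) C) z ^+ #|C| * y))).
  rewrite expR_sum; apply: ler_prod => C _.
  by rewrite expR_ge1Dx andbT addr_ge0 // mulr_ge0 ?exprn_ge0.
rewrite ler_expR -mulr_suml -mulrA (mulrC y) mulrA ler_wpM2r //.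
(* A linked set is nonempty, so summing over its elements counts it at least once. *)
apply: (@le_trans _ _ (\sum_(e in B) \sum_(C : {set {set V}} |
    [&& C \subset B, linked (@meets V) C & e \in C]) z ^+ #|C|)).
  rewrite (exchange_big_dep
    (fun C : {set {set V}} => (C \subset B) && linked (@meets V) C)) /=; last first.
    by move=> e C _ /and3P[-> ->].
  apply: ler_sum => C /andP[CB lC]; have [e eC] := set0Pn _ (proj1 (andP lC)).
  rewrite (bigD1 e) /=; last by rewrite CB lC eC (subsetP CB).
  by rewrite lerDl sumr_ge0 // => f _; rewrite exprn_ge0.
rewrite -[X in _ <= X%:R * _]sum1_card natr_sum mulr_suml; apply: ler_sum => e eB.
by rewrite mul1r; apply: sum_linked_le small eB deg.
Qed.

End Spread.

(** * Degenerate hypergraphs *)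

Section Growth.

Variable R : realType.

Lemma powR_natr_ge (b M : R) : 0 < b ->
  exists n0 : nat, forall n : nat, (n0 <= n)%N -> M <= n%:R `^ b.
Proof.
move=> b_gt0; have [M_le0|M_gt0] := leP M 0.
  by exists 0 => n _; apply: le_trans M_le0 (powR_ge0 _ _).
exists (Num.trunc (M `^ b^-1)).+1 => n n0n.
have le : M `^ b^-1 <= n%:R.
  by apply: ltW; apply: lt_le_trans (truncnS_gt _) _; rewrite ler_nat.
have -> : M = (M `^ b^-1) `^ b by rewrite -powRrM mulVf ?gt_eqF // powRr1 // ltW.
by apply: (ge0_ler_powR (ltW b_gt0)); rewrite ?nnegrE ?powR_ge0.
Qed.

(** Take logarithms: with h the square root of n, ln n = 2 ln h <= 2h, which is below any fixed
    multiple of n = h^2 for large n. *)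
Lemma powR_natr_le_exp2 (b c : R) : 0 < b -> 0 < c ->
  exists n0 : nat, forall n t : nat, (n0 <= n)%N -> (0 < n)%N ->
    c * n%:R <= t%:R -> n%:R `^ b <= 2 ^+ t.
Proof.
move=> b_gt0 c_gt0; have ln2 : 0 < ln 2 :> R by rewrite ln_gt0 // ltr1n.
have half : 0 < 2^-1 :> R by rewrite invr_gt0.
have [n0 n0P] := powR_natr_ge (2 * b / (c * ln 2)) half.
exists n0 => n t n0n n_gt0 nt; have n_gt0' : 0 < n%:R :> R by rewrite ltr0n.
set h := n%:R `^ 2^-1 : R; have h_gt0 : 0 < h by rewrite powR_gt0.
have hh : n%:R = h * h.
  rewrite /h -powRD; last by rewrite pnatr_eq0 -lt0n n_gt0 implybT.
  by rewrite (_ : 2^-1 + 2^-1 = 1 :> R) ?powRr1 //; field.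
have lnh : ln n%:R = 2 * ln h by rewrite /h ln_powR; field.
rewrite /powR gt_eqF // -[leRHS](@lnK R); last by rewrite posrE exprn_gt0.
rewrite ler_expR lnXn // -[leRHS]mulr_natr.
apply: (@le_trans _ _ (ln 2 * (c * n%:R))); last by rewrite ler_wpM2l // ltW.
rewrite lnh hh; apply: (@le_trans _ _ (b * (2 * h))).
  by rewrite !ler_wpM2l // ?ltW // ln_sublinear.
have := n0P n n0n; rewrite -/h ler_pdivrMr ?mulr_gt0 // => le.
rewrite (_ : b * (2 * h) = (2 * b) * h); last by ring.
rewrite (_ : ln 2 * _ = h * (c * ln 2) * h); last by ring.
by rewrite ler_wpM2r // ltW.
Qed.

Lemma exp_near1 (N : nat) : exists2 z : R, 0 < z &
  2 * z <= 1 /\ (1 + 2 * z) ^+ N <= 2.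
Proof.
have ln2 : 0 < ln 2 :> R by rewrite ln_gt0 // ltr1n.
have ln21 : ln 2 <= 1 :> R.
  have : -1 < 1 :> R by lra.
  by move=> /le_ln1Dx; rewrite (_ : 1 + 1 = 2 :> R) //.
(* Chosen so that (1 + 2z)^N <= exp(2zN) <= 2; the successor avoids dividing by zero. *)
exists (ln 2 / N.+1%:R / 2); first by rewrite !divr_gt0.
have -> : 2 * (ln 2 / N.+1%:R / 2) = ln 2 / N.+1%:R :> R.
  by field; rewrite addrC natr1 pnatr_eq0.
split; first by rewrite ler_pdivrMr // (le_trans ln21) // mul1r ler1n.
apply: (@le_trans _ _ (expR (ln 2 / N.+1%:R) ^+ N)).
  by rewrite lerXn2r ?nnegrE ?expR_ge0 ?expR_ge1Dx // addr_ge0 // divr_ge0 // ltW.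
rewrite -expRM_natr -[leRHS](@lnK R) ?posrE // ler_expR.
rewrite -mulrA -[leRHS]mulr1 ler_wpM2l ?(ltW ln2) // mulrC ler_pdivrMr // mul1r.
by rewrite ler_nat.
Qed.

End Growth.

Lemma contains_copy_pulled_back (V : finType) (G H : hypergraph V) (s : {perm V}) :
  pulled_back G s \subset H -> contains_copy G H.
Proof.
move=> /subsetP sH; apply/existsP; exists [ffun x => (s^-1)%g x].
apply/andP; split.
  by apply/injectiveP => x y; rewrite !ffunE; exact: perm_inj.
apply/forallP => e; apply/implyP => eG; apply: sH; rewrite inE.
rewrite (_ : s @: _ = e) //; apply/setP => x; apply/imsetP/idP.
  by case=> _ /imsetP[y ye ->] ->; rewrite ffunE permKV.
move=> xe; exists ((s^-1)%g x); last by rewrite permKV.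
by apply/imsetP; exists x; rewrite ?ffunE.
Qed.

Section Degenerate.

Variables (R : realType) (V : finType) (G : hypergraph V) (k : nat) (d alpha eps : R).
Hypotheses (k_ge2 : (2 <= k)%N) (G_unif : {in G, forall e : {set V}, #|e| = k})
  (G_deg : degenerate d alpha eps G).

(** The image [U] of the covered vertices induces at least [#|C|] edges of [G], so both degeneracy
    conditions apply to [U]; an edge of size k >= 2 gives [U] two vertices. *)
Lemma degenerate_pulled_back (s : {perm V}) (C : hypergraph V) :
  C \subset pulled_back G s -> C != set0 ->
  [/\ (2 <= #|cover C|)%N, (#|cover C| <= k * #|C|)%N,
      #|C|%:R <= d * (#|cover C|%:R - 1) &
      #|cover C|%:R <= eps * #|V|%:R -> #|C|%:R <= d * (#|cover C|%:R - 1) - alpha].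
Proof.
move=> CG /set0Pn[e eC]; set U := s @: cover C.
have Ck f : f \in C -> #|f| = k by move=> /(subsetP CG)/(pulled_back_card G_unif).
have cardU : #|U| = #|cover C| by rewrite card_imset //; exact: perm_inj.
have U_ge2 : (2 <= #|U|)%N.
  rewrite cardU; apply: leq_trans k_ge2 _; rewrite -(Ck e eC).
  by apply/subset_leq_card/subsetP => x xe; apply/bigcupP; exists e.
have CU : (#|C| <= #|induced G U|)%N.
  rewrite -(card_imset _ (imset_inj (@perm_inj _ s))).
  apply/subset_leq_card/subsetP => _ /imsetP[f fC ->].
  rewrite inE; have := subsetP CG _ fC; rewrite inE => -> /=.
  by apply/imsetS/subsetP => x xf; apply/bigcupP; exists f.
have [m1d small] := G_deg.
rewrite -cardU; split=> //.
- rewrite cardU; apply: leq_trans (leq_card_cover _) _.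
  by rewrite (eq_bigr (fun=> k)) // sum_nat_const mulnC.
- apply: (@le_trans _ _ #|induced G U|%:R); first by rewrite ler_nat.
  rewrite -ler_pdivrMr; last by rewrite subr_gt0 ltr1n.
  apply: le_trans m1d; pose F := (U, induced G U).
  apply: (le_bigmax_cond (j := F) _ (fun F => #|F.2|%:R / (#|F.1|%:R - 1))).
  rewrite /F /= U_ge2 andbT /subhypergraph /=; apply/andP; split.
    by apply/subsetP => f; rewrite inE => /andP[].
  by apply/forallP => f; apply/implyP; rewrite inE => /andP[].
move=> /(small U U_ge2); apply: le_trans; by rewrite ler_nat.
Qed.

End Degenerate.

Section Weight.

Variables (R : realType) (k : nat) (d alpha eps : R).
Hypotheses (k_gt0 : (0 < k)%N) (d_gt0 : 0 < d) (alpha_gt0 : 0 < alpha) (eps_gt0 : 0 < eps).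

(* A component with [t] edges on [v] vertices gains [n `^ (- alpha / d)] from the
   [alpha] in the degeneracy when [v <= eps * n]; larger components have linearly
   many edges, and then [2 ^+ t] pays for it. *)
Lemma component_weight_le : exists n0 : nat, forall n t v : nat,
  (n0 <= n)%N -> (0 < n)%N -> (v <= k * t)%N ->
  t%:R <= d * (v%:R - 1) -> (v%:R <= eps * n%:R -> t%:R <= d * (v%:R - 1) - alpha) ->
  (n%:R `^ (- d^-1)) ^- t * (n%:R * n%:R ^- v) <= 2 ^+ t * n%:R `^ (- (alpha / d)).
Proof.
have b_gt0 : 0 < alpha / d by rewrite divr_gt0.
have c_gt0 : 0 < eps / k%:R by rewrite divr_gt0 ?ltr0n.
have [n0 n0P] := powR_natr_le_exp2 b_gt0 c_gt0.
exists n0 => n t v n0n n_gt0 vkt tv tv_small.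
have n_ge1 : 1 <= n%:R :> R by rewrite ler1n.
have n_gt0' : 0 < n%:R :> R by rewrite ltr0n.
have -> : (n%:R `^ (- d^-1)) ^- t * (n%:R * n%:R ^- v) = n%:R `^ (t%:R / d + (1 - v%:R)).
  have -> : (n%:R `^ (- d^-1)) ^- t = n%:R `^ (t%:R / d) :> R.
    by rewrite -powR_mulrn ?powR_ge0 // -powRrM -powRN mulNr opprK mulrC.
  rewrite powRD; last by rewrite (gt_eqF n_gt0') implybT.
  rewrite powRD; last by rewrite (gt_eqF n_gt0') implybT.
  by rewrite powRr1 // powR_invn.
have two_ge1 : 1 <= 2 ^+ t :> R by rewrite exprn_ege1 // ler1n.
have [v_small|v_large] := leP v%:R (eps * n%:R).
  apply: (@le_trans _ _ (n%:R `^ (- (alpha / d)))); last first.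
    by rewrite -[leLHS]mul1r ler_wpM2r ?powR_ge0.
  apply: ler_powR => //; rewrite -(ler_pM2l d_gt0).
  rewrite (_ : d * _ = t%:R + d * (1 - v%:R)); last by field; rewrite gt_eqF.
  rewrite (_ : d * - _ = - alpha); last by field; rewrite gt_eqF.
  by have := tv_small v_small; lra.
apply: (@le_trans _ _ 1).
  rewrite -[leRHS](powRr0 n%:R); apply: ler_powR => //; rewrite -(ler_pM2l d_gt0).
  rewrite (_ : d * _ = t%:R + d * (1 - v%:R)); last by field; rewrite gt_eqF.
  by rewrite mulr0; lra.
rewrite powRN ler_pdivlMr ?powR_gt0 // mul1r; apply: n0P => //.
rewrite mulrAC ler_pdivrMr ?ltr0n //; apply: le_trans (ltW v_large) _.
by rewrite -natrM ler_nat mulnC.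
Qed.

End Weight.

(** The constant multiplying [q] absorbs 2^t, D^t and 4^v <= 4^(kt), leaving x^t. Using [D + 1]
    keeps it positive when [D] is 0. *)
Lemma scaled_weight_le (R : realFieldType) (D x q N y : R) (k t v : nat) :
  0 < x -> 0 <= D -> 0 < q -> 0 < N -> (v <= k * t)%N ->
  q ^- t * (N * N ^- v) <= 2 ^+ t * y ->
  (2 * (D + 1) * 4 ^+ k / x * q) ^- t * (N * D ^+ t * (4 / N) ^+ v) <= x ^+ t * y.
Proof.
move=> x_gt0 D_ge0 q_gt0 N_gt0 vkt le.
have [c cE] : exists c, c = 2 * (D + 1) * 4 ^+ k / x by eexists.
have c_gt0 : 0 < c by rewrite cE !mulr_gt0 ?invr_gt0 ?exprn_gt0 // ltr_wpDl.
have ct_ge0 : 0 <= c ^- t by rewrite invr_ge0 exprn_ge0 // ltW.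
rewrite -cE exprMn invfM expr_div_n.
have E (a1 a2 a3 a4 a5 a6 : R) :
  a1 * a2 * (a3 * a4 * (a5 * a6)) = (a1 * a4 * a5) * (a2 * (a3 * a6)) by ring.
rewrite {}E.
apply: (@le_trans _ _ ((c ^- t * (D + 1) ^+ t * 4 ^+ (k * t)) * (2 ^+ t * y))).
  have cDt_ge0 : 0 <= c ^- t * D ^+ t by rewrite mulr_ge0 ?exprn_ge0.
  apply: ler_pM le; first by rewrite mulr_ge0 ?exprn_ge0.
    by rewrite !mulr_ge0 ?invr_ge0 ?exprn_ge0 ?(ltW q_gt0) ?(ltW N_gt0).
  apply: ler_pM => //; first by rewrite exprn_ge0.
    by rewrite ler_wpM2l // lerXn2r ?nnegrE ?addr_ge0 // lerDl.
  by rewrite ler_weXn2l // ler1n.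
rewrite exprM -exprVn mulrA -!exprMn (_ : c^-1 * (D + 1) * 4 ^+ k * 2 = x) //.
rewrite cE; field.
by rewrite (gt_eqF x_gt0) expf_neq0 ?pnatr_eq0 //= gt_eqF // ltr_wpDl.
Qed.

(** * Containment after a bounded number of rounds *)

Section Containment.

Variables (R : realType) (k Delta : nat) (d alpha eps : R)
  (G : forall n : nat, hypergraph 'I_n).
Hypotheses (k_ge2 : (2 <= k)%N) (d_gt0 : 0 < d) (alpha_gt0 : 0 < alpha)
  (eps_gt0 : 0 < eps)
  (G_unif : forall n, uniform k (G n))
  (G_degenerate : forall n, degenerate d alpha eps (G n))
  (G_deg : forall n, (max_degree (G n) <= Delta)%N).

Definition ksets n : hypergraph 'I_n := [set e : {set 'I_n} | #|e| == k].

(** Run [r] rounds of density [p0] on the family of all n! copies; each round shrinks the size bound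
    by n^b, up to rounding, and loses at most a proportion e / lam of the copies. *)
Lemma containment_bound (delta : R) : 0 < delta ->
  exists2 c : R, 0 < c & exists n0 : nat, forall n : nat, (n0 <= n)%N ->
    forall p : R, 0 <= p <= 1 -> c * n%:R `^ (- d^-1) <= p ->
    Ebern (ksets n) p (fun W => (~~ contains_copy (G n) W)%:R) <= delta.
Proof.
move=> delta_gt0; have k_gt0 : (0 < k)%N by apply: leq_trans k_ge2.
set b := alpha / d; have b_gt0 : 0 < b by rewrite divr_gt0.
(* Since r - 1 >= 1 / b, the bound [f 0] below is at most Delta n^(-b). The choice of [lam] makes
   [r] losses of e / lam sum to at most [delta]. *)
pose r := (Num.trunc b^-1).+2; pose lam := expR 1 + r%:R * expR 1 / delta.
have e_gt0 : 0 < expR 1 :> R := expR_gt0 1.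
have lam_ge : expR 1 <= lam by rewrite lerDl !mulr_ge0 ?invr_ge0 // ltW.
have lam_gt0 : 0 < lam by apply: lt_le_trans lam_ge.
have lam_ge1 : 1 <= lam by apply: le_trans lam_ge; rewrite -[leLHS]expR0 ler_expR.
have [z z_gt0 [z_le z_exp]] := exp_near1 R (k * Delta).
(* [z] fits the exploration with degree k Delta; dividing by [lam] leaves room for the extra weight
   in [sum_embeddings_le]. *)
pose x := z / lam; have x_gt0 : 0 < x by rewrite divr_gt0.
have lamx : lam * x = z by rewrite /x mulrC divfK ?gt_eqF.
pose D : R := (Delta * k ^ k)%:R; pose c0 : R := 2 * (D + 1) * 4 ^+ k / x.
have D_ge0 : 0 <= D by [].
have c0_gt0 : 0 < c0 by rewrite !mulr_gt0 ?invr_gt0 ?exprn_gt0 // ltr_wpDl.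
have [n1 n1P] := component_weight_le k_gt0 d_gt0 alpha_gt0 eps_gt0.
have [n2 n2P] := powR_natr_ge (Delta.+1)%:R b_gt0.
exists (r%:R * c0); first by rewrite mulr_gt0.
exists (maxn 1 (maxn n1 n2)) => n; rewrite !geq_max => /and3P[n_gt0 n1n n2n] p p01 cp.
have n_ge1 : 1 <= n%:R :> R by rewrite ler1n.
have n_gt0' : 0 < n%:R :> R by rewrite ltr0n.
set q : R := n%:R `^ (- d^-1); have q_gt0 : 0 < q by rewrite powR_gt0.
pose p0 := c0 * q; have p0_gt0 : 0 < p0 by rewrite mulr_gt0.
have rp0 : r%:R * p0 <= p by rewrite mulrA.
have p0_lt1 : p0 < 1.
  have /andP[_ p1] := p01; have : r%:R * p0 <= 1 := le_trans rp0 p1.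
  by move=> le; apply: lt_le_trans le; rewrite -[ltLHS]mul1r ltr_pM2r // ltr1n.
(* The unrounded size bound with [j] rounds to go: [f r] is Delta n, which bounds the number of
   edges, and [f j] is [f j.+1] times n^(-b). *)
pose f (j : nat) : R := Delta%:R * n%:R `^ (1 - (r%:R - j%:R) * b).
have f_ge0 j : 0 <= f j by rewrite mulr_ge0 ?powR_ge0.
pose m j := (Num.trunc (f j)).+1.
have unif : {in G n, forall e : {set 'I_n}, #|e| = k}.
  by move=> e eG; have /forallP/(_ e) := G_unif n; rewrite eG => /eqP.
have deg v : (#|[set e in G n | v \in e]| <= Delta)%N.
  by apply: leq_trans (G_deg n); rewrite /max_degree (bigD1 v) //= leq_maxl.
have m0 : m 0 = 1.
  rewrite /m; congr _.+1; apply/truncn0Pn; rewrite -ltNge /f subr0.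
  apply: (@le_lt_trans _ _ (Delta%:R * n%:R `^ (- b))).
    rewrite ler_wpM2l //; apply: ler_powR => //.
    have : b^-1 <= r.-1%:R by rewrite ltW // truncnS_gt.
    rewrite -(ler_pM2r b_gt0) mulVf ?gt_eqF // -natr1 mulrDl mul1r => le.
    by rewrite -natr1 mulrDl mul1r; lra.
  rewrite powRN ltr_pdivrMr ?powR_gt0 // mul1r; apply: lt_le_trans (n2P n n2n).
  by rewrite ltr_nat.
have mr : (#|G n| < m r)%N.
  rewrite /m /f subrr mul0r subr0 powRr1 // ltnS.
  apply: (leq_trans (card_hypergraph_le unif deg k_gt0)).
  by rewrite card_ord truncn_ge_nat ?mulr_ge0 // natrM mulrC.
pose eta : R := n`!%:R * (expR 1 / lam).
have eta_ge0 : 0 <= eta by rewrite mulr_ge0 // divr_ge0 // ltW.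
have sub s : pulled_back (G n) s \subset ksets n.
  by apply/subsetP => e /(pulled_back_card unif) ek; rewrite inE ek.
have p0_01 : 0 < p0 < 1 by rewrite p0_gt0.
have small j (s : {perm 'I_n}) (B : {set {set 'I_n}}) :
    B \subset pulled_back (G n) s -> (#|B| < m j.+1)%N ->
    \sum_(T : {set {set 'I_n}} | (T \subset B) && (m j <= #|T|)%N)
      p0 ^- #|T| * #|[set s' | T \subset pulled_back (G n) s']|%:R <= eta.
  move=> BG; rewrite ltnS truncn_ge_nat // => Bm.
  have y_ge0 : 0 <= n%:R `^ (- b) :> R := powR_ge0 _ _.
  have n_gt0'' : (0 < #|'I_n|)%N by rewrite card_ord.
  apply: le_trans (sum_embeddings_le unif deg k_gt0 (m j) n_gt0'' BG p0_gt0 lam_ge1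
    (ltW x_gt0) y_ge0 _ _) _.
  - by rewrite lamx.
  - move=> C CB /andP[C0 _]; rewrite card_ord -/D.
    have [_ vkt tv tv_small] :=
      degenerate_pulled_back k_ge2 unif (G_degenerate n) (subset_trans CB BG) C0.
    rewrite card_ord in tv_small.
    have := n1P n #|C| #|cover C| n1n n_gt0 vkt tv tv_small; rewrite -/q -/b.
    by apply: scaled_weight_le.
  rewrite card_ord lamx /eta ler_wpM2l //.
  have m_gt0 : (0 < m j)%N by [].
  (* As 2z <= 1, the exponent is at most #|B| n^(-b) <= f j < m j. This leaves (e / lam)^(m j), at
     most e / lam because m j >= 1 and e <= lam. *)
  apply: (@le_trans _ _ ((expR 1 / lam) ^+ m j)); last first.
    by apply: ler_iXnr => //;
      rewrite ?divr_ge0 ?(ltW e_gt0) ?(ltW lam_gt0) //= ler_pdivrMr // mul1r.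
  rewrite expr_div_n mulrC ler_wpM2r ?invr_ge0 ?exprn_ge0 ?(ltW lam_gt0) //.
  rewrite -expRM_natr mul1r ler_expR.
  apply: (@le_trans _ _ (#|B|%:R * n%:R `^ (- b))).
    by rewrite -[leRHS]mulr1 ler_wpM2l // mulr_ge0.
  apply: (@le_trans _ _ (f j)); last by rewrite ltW // truncnS_gt.
  apply: (@le_trans _ _ (f j.+1 * n%:R `^ (- b))); first by rewrite ler_wpM2r.
  rewrite /f -mulrA -powRD; last by rewrite (gt_eqF n_gt0') implybT.
  rewrite ler_wpM2l //; apply: ler_powR => //; rewrite -[j.+1%:R]natr1.
  by rewrite le_eqVlt; apply/orP; left; apply/eqP; ring.
have sub_id : {in [set: {perm 'I_n}], forall s,
    pulled_back (G n) s \subset pulled_back (G n) s}.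
  by [].
have card_lt : {in [set: {perm 'I_n}], forall s, (#|pulled_back (G n) s| < m r)%N}.
  move=> s _; apply: leq_ltn_trans mr.
  rewrite -(card_imset _ (imset_inj (@perm_inj _ s))).
  by apply/subset_leq_card/subsetP => _ /imsetP[e + ->]; rewrite inE.
have := iterated_fragmentation p0_01 eta_ge0 sub m0 small sub_id card_lt rp0 p01.
rewrite cardsT card_Sn subrr add0r.
rewrite /eta (mulrCA r%:R) ler_pM2l ?ltr0n ?fact_gt0 // => le.
apply: le_trans (_ : r%:R * (expR 1 / lam) <= _); last first.
  rewrite mulrA ler_pdivrMr // mulrDr -[leLHS]add0r lerD //; first by rewrite mulr_ge0 // ltW.
  by rewrite [leRHS]mulrC divfK // gt_eqF.
apply: le_trans le; apply: ler_Ebern => // W _; rewrite ler_nat.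
case: (boolP (contains_copy _ _)) => //= noc; rewrite lt0b.
apply/existsP => -[s /andP[_ sW]]; case/negP: noc.
exact: contains_copy_pulled_back sW.
Qed.

End Containment.

(** * Threshold functions *)

From mathcomp Require Import all_classical all_reals all_analysis.
Import Order.TTheory GRing.Theory Num.Theory.
Import numFieldNormedType.Exports.
Local Open Scope ring_scope.
Local Open Scope classical_set_scope.

Section Threshold.

Variables (R : realType) (k : nat).
Implicit Types (n : nat) (p q : R).

Lemma random_hypergraph_probE n p (A : pred (hypergraph 'I_n)) :
  random_hypergraph_prob k p A = Ebern (ksets k n) p (fun H => (A H)%:R).
Proof.
rewrite /random_hypergraph_prob /Ebern big_mkcondr /=; apply: eq_big => H.
  rewrite inE; apply/forallP/fintype.subsetP => [HG e eH | HG e].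
    by rewrite inE; have := HG e; rewrite eH.
  by apply/implyP => /HG; rewrite inE.
move=> _; case: ifP => _; rewrite ?mulr0 // mulr1.
by apply: eq_bigl => e; rewrite inE.
Qed.

Lemma random_hypergraph_prob_predC n p (A : pred (hypergraph 'I_n)) :
  random_hypergraph_prob k p A = 1 - random_hypergraph_prob k p (fun H => ~~ A H).
Proof.
apply/eqP; rewrite -subr_eq opprK !random_hypergraph_probE -EbernD.
rewrite (@eq_Ebern _ _ _ _ _ (fun=> 1)) ?Ebern_cst // => W _.
by case: (A W); rewrite ?addr0 ?add0r.
Qed.

Definition noncontainment (G : forall n, hypergraph 'I_n) n p : R :=
  random_hypergraph_prob k p (fun H : hypergraph 'I_n => ~~ contains_copy (G n) H).

Variable G : forall n, hypergraph 'I_n.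
Local Notation fail := (noncontainment G).

Lemma contains_copyS (V W : finType) (F : hypergraph V) (H H' : hypergraph W) :
  H \subset H' -> contains_copy F H -> contains_copy F H'.
Proof.
move=> /fintype.subsetP HH' /existsP[phi /andP[inj /forallP FH]]; apply/existsP; exists phi.
by rewrite inj; apply/forallP => e; apply/implyP => eF; apply: HH'; apply: (implyP (FH e)).
Qed.

(* Bollobas-Thomason: [m] independent rounds of density [p] are contained in one
   of density [q]. *)
Lemma noncontainment_pow n (m : nat) p q : 0 <= p <= 1 -> 0 <= q <= 1 ->
  m%:R * p <= q -> fail n q <= fail n p ^+ m.
Proof.
move=> p01 q01 mpq; rewrite /noncontainment !random_hypergraph_probE.
apply: Ebern_submul_pow => // [W|W1 W2]; first by rewrite ler0n lern1 leq_b1.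
case: (boolP (contains_copy (G n) W1)) => /= [/(contains_copyS (finset.subsetUl _ _)) ->|_].
  by rewrite mul0r.
rewrite mul1r ler_nat; case: (boolP (contains_copy (G n) W2)) => [|_]; last exact: leq_b1.
by move=> /(contains_copyS (finset.subsetUr _ _)) ->.
Qed.

Lemma noncontainment_ge0 n p : 0 <= p <= 1 -> 0 <= fail n p.
Proof.
move=> p01; rewrite /noncontainment random_hypergraph_probE.
by rewrite -(Ebern_cst (ksets k n) p 0); apply: ler_Ebern.
Qed.

Lemma noncontainment_le1 n p : 0 <= p <= 1 -> fail n p <= 1.
Proof.
move=> p01; rewrite /noncontainment random_hypergraph_probE.
rewrite -[leRHS](Ebern_cst (ksets k n) p); apply: ler_Ebern => // W _.
by rewrite lern1 leq_b1.
Qed.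

Lemma whp_contains (p : nat -> R) : edge_probability p ->
  (forall delta : R, 0 < delta -> \forall n \near \oo, fail n (p n) <= delta) ->
  whp k p (fun n H => contains_copy (G n) H).
Proof.
move=> p01 small; apply/cvgrPdist_le => delta delta_gt0.
near=> n; rewrite random_hypergraph_prob_predC opprB addrCA subrr addr0.
by rewrite ger0_norm ?noncontainment_ge0 //; near: n; exact: small.
Unshelve. all: by end_near.
Qed.

(** The density where containment has probability one half. For an edgeless hypergraph the set is
    empty, and the value 1 keeps the function positive. *)
Definition half_threshold n : R :=
  if G n == finset.set0 then 1 else sup [set p | 0 <= p <= 1 /\ 2^-1 <= fail n p].

Section HalfThreshold.

Variable n : nat.
Hypothesis Gn_neq0 : G n != finset.set0.

(** A copy of a nonempty hypergraph needs at least one edge, so the union bound applies. *)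
Lemma noncontainment_small p : 0 <= p <= 1 ->
  #|ksets k n|%:R * p <= 2^-1 -> 2^-1 <= fail n p.
Proof.
move=> p01 le; rewrite /noncontainment.
have := random_hypergraph_prob_predC p (fun H : hypergraph 'I_n => contains_copy (G n) H).
rewrite random_hypergraph_probE => /esym E.
suff : Ebern (ksets k n) p (fun W => (contains_copy (G n) W)%:R) <= 2^-1 by move: E; lra.
apply: le_trans le; apply: le_trans (Ebern_nonempty_le _ p01).
apply: ler_Ebern => // W _; rewrite ler_nat; case: eqVneq => [->|_]; last exact: leq_b1.
case: (boolP (contains_copy (G n) finset.set0)) => // /existsP[phi /andP[_ /forallP H]].
have [e eG] := finset.set0Pn _ Gn_neq0.
by have := H e; rewrite eG finset.inE.
Qed.

Lemma half_threshold_has_sup : has_sup [set p | 0 <= p <= 1 /\ 2^-1 <= fail n p].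
Proof.
split; last by exists 1 => p [/andP[]].
exists 0; split; first by rewrite lexx ler01.
by apply: noncontainment_small; rewrite ?mulr0 ?lexx ?ler01 ?invr_ge0.
Qed.

Lemma half_threshold_gt0 : 0 < half_threshold n.
Proof.
rewrite /half_threshold (negbTE Gn_neq0).
set N := #|ksets k n|; pose p : R := (2 * N.+1%:R)^-1.
have p_gt0 : 0 < p by rewrite invr_gt0 mulr_gt0.
apply: (lt_le_trans p_gt0); apply: ub_le_sup; first by have [] := half_threshold_has_sup.
have p01 : 0 <= p <= 1.
  by rewrite ltW //= invf_le1 ?mulr_gt0 // -natrM ler1n muln_gt0.
split=> //; apply: noncontainment_small => //; rewrite -/N /p invfM mulrCA.
rewrite -[leRHS]mulr1 ler_wpM2l ?invr_ge0 // ler_pdivrMr // mul1r ler_nat.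
exact: leqnSn.
Qed.

Lemma half_threshold_le1 : half_threshold n <= 1.
Proof.
rewrite /half_threshold (negbTE Gn_neq0); apply: ge_sup.
  by have [] := half_threshold_has_sup.
by move=> p [/andP[]].
Qed.

Lemma noncontainment_above p : 0 <= p <= 1 -> half_threshold n < p ->
  fail n p < 2^-1.
Proof.
rewrite /half_threshold (negbTE Gn_neq0) => p01; apply: contraTlt => ge.
rewrite -leNgt; apply: ub_le_sup; first by have [] := half_threshold_has_sup.
by split.
Qed.

Lemma noncontainment_below p : 0 <= p <= 1 -> p < half_threshold n ->
  2^-1 <= fail n p.
Proof.
rewrite /half_threshold (negbTE Gn_neq0) => p01 lt.
have [q [q01 qf] pq] := sup_gt (proj1 half_threshold_has_sup) lt.
(* Monotonicity of failure in the density is the one-round case. *)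
apply: le_trans qf _; rewrite -[leRHS]expr1; apply: noncontainment_pow => //.
by rewrite mul1r ltW.
Qed.

End HalfThreshold.

Lemma expr_lt_small (a b : R) : 0 <= a < 1 -> 0 < b ->
  exists2 m : nat, (0 < m)%N & a ^+ m < b.
Proof.
move=> /andP[a_ge0 a_lt1] b_gt0; have a_norm : `|a| < 1 by rewrite ger0_norm.
have /cvgrPdist_lt/(_ b b_gt0)[N _ NP] := cvg_expr a_norm.
exists N.+1 => //; have := NP N.+1 (leqnSn N).
by rewrite sub0r normrN ger0_norm // exprn_ge0.
Qed.

(** Amplification in both directions. Far above, m rounds each failing with probability at most 1/2
    all fail with probability at most 2^-m. Far below, failure with probability at most 1 - delta
    would bring failure at density m p under 1/2, although m p is still below the supremum. *)
Lemma half_threshold_function : (\forall n \near \oo, G n != finset.set0) ->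
  threshold_function k G half_threshold.
Proof.
move=> G0; split=> [n|p p01].
  have [E|E] := eqVneq (G n) finset.set0; last exact: half_threshold_gt0.
  by rewrite /half_threshold E eqxx.
split=> [p_large|p_small].
  apply: whp_contains => // delta delta_gt0.
  have half01 : 0 <= (2^-1 : R) < 1 by rewrite invr_ge0 ler0n invf_lt1 ?ltr1n.
  have [m m_gt0 /ltW mP] := expr_lt_small half01 delta_gt0.
  have /cvgryPge p_ge := p_large.
  near=> n.
  have Gn : G n != finset.set0 by near: n.
  have th_gt0 := half_threshold_gt0 Gn.
  (* [noncontainment_above] asks for a density strictly above the supremum, so each of the [m]
     rounds gets twice it. *)
  have large : 2 * m%:R * half_threshold n <= p n.
    rewrite -ler_pdivlMr //; near: n; exact: p_ge.
  set th := half_threshold n in th_gt0 large *.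
  have /andP[pn0 pn1] := p01 n.
  have th2 : 2 * th <= p n.
    apply: le_trans large; rewrite ler_wpM2r ?(ltW th_gt0) // ler_peMr // ler1n //.
  have th01 : 0 <= 2 * th <= 1 by rewrite mulr_ge0 ?(ltW th_gt0) //= (le_trans th2).
  apply: le_trans mP; apply: (le_trans (@noncontainment_pow n m (2 * th) (p n) th01 (p01 n) _)).
    by rewrite mulrA (mulrC _ 2).
  rewrite lerXn2r ?nnegrE ?noncontainment_ge0 ?invr_ge0 // ltW // noncontainment_above //.
  by rewrite mulr_natl mulr2n ltrDl.
apply/cvgrPdist_le => delta delta_gt0.
(* The maximum with 0 covers delta > 1. *)
pose a := Num.max 0 (1 - delta).
have a01 : 0 <= a < 1 by rewrite le_max lexx /= gt_max ltr01 ltrBlDr ltrDl.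
have half_gt0 : 0 < 2^-1 :> R by rewrite invr_gt0.
have [m m_gt0 mP] := expr_lt_small a01 half_gt0.
have m_inv_gt0 : 0 < m%:R^-1 :> R by rewrite invr_gt0 ltr0n.
have /cvgrPdist_lt/(_ _ m_inv_gt0) p_lt := p_small.
near=> n; rewrite -/(noncontainment G n (p n)).
have Gn : G n != finset.set0 by near: n.
have th_gt0 := half_threshold_gt0 Gn.
have small : m%:R * p n < half_threshold n.
  rewrite mulrC -ltr_pdivlMr ?ltr0n //.
  have : p n / half_threshold n < m%:R^-1.
    have : `|0 - p n / half_threshold n| < m%:R^-1 by near: n; exact: p_lt.
    by rewrite sub0r normrN; apply: le_lt_trans; exact: ler_norm.
  by rewrite ltr_pdivrMr // mulrC.
have mp01 : 0 <= m%:R * p n <= 1.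
  rewrite mulr_ge0 //=; last by have /andP[] := p01 n.
  exact: le_trans (ltW small) (half_threshold_le1 Gn).
have f_le1 := noncontainment_le1 n (p01 n); have f_ge0 := noncontainment_ge0 n (p01 n).
rewrite ger0_norm ?subr_ge0 // lerBlDr -lerBlDl.
have [le|/ltW] := leP (fail n (p n)) a; last first.
  by apply: le_trans; rewrite le_max lexx orbT.
have := noncontainment_below Gn mp01 small; rewrite leNgt => /negP[].
apply: le_lt_trans mP; apply: le_trans (noncontainment_pow n (p01 n) mp01 (lexx _)) _.
by rewrite lerXn2r ?nnegrE // le_max lexx.
Unshelve. all: by end_near.
Qed.

End Threshold.

Theorem theorem1p4 (R : realType) (k Delta : nat) (d alpha eps : R)
    (G : forall n : nat, hypergraph 'I_n)
    (hk : (2 <= k)%N) (hd : 0 < d) (halpha : 0 < alpha)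
    (heps0 : 0 < eps) (heps1 : eps < 1)
    (huniform : forall n, uniform k (G n))
    (hdegenerate : forall n, degenerate d alpha eps (G n))
    (hdegree : forall n, (max_degree (G n) <= Delta)%N) :
  ((\forall n \near \oo, G n != finset.set0) ->
     threshold_le k G (fun n => n%:R `^ (- d^-1))) /\
  (forall p : nat -> R, edge_probability p ->
     (fun n => p n * n%:R `^ d^-1) @ \oo --> +oo ->
     whp k p (fun n H => contains_copy (G n) H)).
Proof.
have bound := containment_bound hk hd halpha heps0 huniform hdegenerate hdegree.
split=> [G0|p p01 p_large].
  exists (half_threshold R k G); split; first exact: half_threshold_function.
  (* Any constant below 1/2 serves: failure at most 1/3 at density c n^(-1/d) shows that this
     density is not below [half_threshold]. *)
  have third_gt0 : 0 < 3^-1 :> R by rewrite invr_gt0.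
  have [c c_gt0 [n0 n0P]] := bound _ third_gt0.
  apply/eqO_exP; exists c => //; near=> n.
  have Gn : G n != finset.set0 by near: n.
  have n0n : (n0 <= n)%N by near: n; exact: nbhs_infty_ge.
  rewrite !ger0_norm ?powR_ge0 ?(ltW (half_threshold_gt0 R k Gn)) // leNgt.
  apply/negP => lt; set q := c * _ in lt.
  have q_ge0 : 0 <= q by rewrite mulr_ge0 ?powR_ge0 // ltW.
  have q01 : 0 <= q <= 1 by rewrite q_ge0 (le_trans (ltW lt)) // half_threshold_le1.
  have := noncontainment_below Gn q01 lt.
  rewrite /noncontainment random_hypergraph_probE => le.
  have := n0P n n0n q q01 (lexx _); move/(le_trans le); lra.
apply: whp_contains => // delta delta_gt0.
have [c c_gt0 [n0 n0P]] := bound _ delta_gt0.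
have /cvgryPge p_ge := p_large.
near=> n; rewrite /noncontainment random_hypergraph_probE; apply: n0P => //.
  by near: n; exact: nbhs_infty_ge.
have n_gt0 : (0 < n)%N by near: n; exact: nbhs_infty_gt.
rewrite powRN ler_pdivrMr ?powR_gt0 ?ltr0n //.
by near: n; exact: p_ge.
Unshelve. all: by end_near.
Qed.
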